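(* Let $X$ be a complex manifold, $\pi:E\to X$ a holomorphic vector bundle with a full flag structure $\mathcal F$, and $k$ a positive integer. Let $\mathcal U=\{U_i\}_{i\in I}$ be an open cover of $X$ ($I$ an ordered set) and $g=\{g_{ij}\}$ a system of transition functions associated with a certain trivialization of $E$ with respect to $\mathcal F$ and $\mathcal U$. Then there is a well-defined Čech $k$-cocycle $$\widehat f^r_{k,\mathcal U}(E,\mathcal F):=(t_{i_1\cdots i_{k+1}})_{i_1<\cdots<i_{k+1}},\qquad t_{i_1\cdots i_{k+1}}\in\Gamma(U_{i_1\cdots i_{k+1}},d\Omega^{k-1}),$$ with coefficients in $d\Omega^{k-1}$, where $$t_{i_1\cdots i_{k+1}}:=\sum_{\sigma\in S_{k+1}}\frac{\mathrm{sgn}(\sigma)}{(k+1)!}\,\mathrm{tr}\Big(\prod_{l=1}^{k} g^{-1}_{i_{\sigma(l)}i_{\sigma(k+1)}}dg_{i_{\sigma(l)}i_{\sigma(k+1)}}\Big)$$ (factors ordered $l=1,\dots,k$ from left to right). Denote by $f_k^r(E,\mathcal F)$ the image of $\widehat f^r_{k,\mathcal U}(E,\mathcal F)$ in $\check H^k(X,d\Omega^{k-1})$ under the canonical homomorphism. Then $f_k^r(E,\mathcal F)$ is independent of the choice of $\mathcal U$ (and of the system $g$ with respect to $\mathcal F$ and $\mathcal U$).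
   Context: $d\Omega^{q}$ ($q\ge0$) is the sheaf of germs of $d$-closed holomorphic $(q+1)$-forms on $X$. A full flag structure $\mathcal F$ on a holomorphic vector bundle $E$ of rank $M$ is a filtration by holomorphic subbundles $E=E_M\supset E_{M-1}\supset\cdots\supset E_1\supset E_0=0$ with line bundle quotients $L_i=E_i/E_{i-1}$. A system of transition functions with respect to $\mathcal F$ and $\mathcal U$ is a system of holomorphic maps $g_{ij}:U_i\cap U_j\to GL(M,\mathbb C)$, $\phi_i\circ\phi_j^{-1}(z,v)=(z,g_{ij}(z)v)$, arising from trivializations $\phi_i:E|_{U_i}\to U_i\times\mathbb C^M$ adapted to the flag (mapping each $E_p|_{U_i}$ onto $U_i\times(\mathbb C^p\times 0)$), so that all $g_{ij}$ are upper triangular. $U_{i_1\cdots i_p}=U_{i_1}\cap\cdots\cap U_{i_p}$; $dg_{ij}$ is the entrywise differential; products are matrix products with entries multiplied by wedge. Čech $k$-cochains are families of sections indexed by $i_1<\cdots<i_{k+1}$ with differential $(\partial s)_{i_1\cdots i_{k+2}}=\sum_j(-1)^{j+1}s_{i_1\cdots\widehat{i_j}\cdots i_{k+2}}$; $\check H^k(\mathcal U,\cdot)$ is the resulting cohomology and $\check H^k(X,\cdot)=\varinjlim_{\mathcal U}\check H^k(\mathcal U,\cdot)$ over open covers under refinement. $f_k^r(E,\mathcal F)$ is called the refined $k$-th $T$ invariant. *)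

(* Defs.v *)
From HB Require Import structures.
From Stdlib Require Import Relation_Operators.
From mathcomp Require Import all_boot all_order all_algebra all_fingroup.
From mathcomp Require Import complex.
From mathcomp Require Import all_classical all_reals all_analysis.
Set Implicit Arguments.
Unset Strict Implicit.
Unset Printing Implicit Defensive.
Import Order.TTheory GRing.Theory Num.Theory numFieldNormedType.Exports.
Local Open Scope ring_scope.
Local Open Scope classical_set_scope.

(* The complex numbers.  Going through numClosedFieldType gives them, and the
   spaces 'rV[Cx R]_n, their normed-module structure. *)
Definition Cx (R : realType) : numClosedFieldType := R[i]%C.

(** * Holomorphic functions and complex manifolds *)

(* [differentiable] is over the field Cx R, hence complex differentiability.  *)
Fixpoint cdifferentiable_upto (R : realType) (n m : nat)
    (D : set 'rV[Cx R]_n) (f : 'rV[Cx R]_n -> Cx R) : Prop :=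
  (forall z, D z -> differentiable f z) /\
  (if m is m'.+1
   then forall v, cdifferentiable_upto m' D (fun z => 'd f z v) else True).

(* Smooth functions whose differentials are complex linear, i.e. smooth
   solutions of the Cauchy-Riemann equations, on an open set D of C^n. *)
Definition holomorphic (R : realType) (n : nat)
    (D : set 'rV[Cx R]_n) (f : 'rV[Cx R]_n -> Cx R) : Prop :=
  forall m, cdifferentiable_upto m D f.

(* A Hausdorff space with a holomorphic atlas; [cinv a] is the inverse of the
   chart [cmap a : cdom a -> cmap a @` cdom a].  No countability axiom is
   required, so this covers manifolds with or without it. *)
Record complex_manifold (R : realType) (n : nat) := ComplexManifold {
  mpoint :> topologicalType;
  chart : Type;
  cdom : chart -> set mpoint;
  cmap : chart -> mpoint -> 'rV[Cx R]_n;
  cinv : chart -> 'rV[Cx R]_n -> mpoint;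
  manifold_hausdorff : hausdorff_space mpoint;
  cdom_open : forall a, open (cdom a);
  cdom_cover : forall x, exists a, cdom a x;
  cimg_open : forall a, open (cmap a @` cdom a);
  cmapK : forall a x, cdom a x -> cinv a (cmap a x) = x;
  cmap_continuous : forall a, {within cdom a, continuous (cmap a)};
  cinv_continuous : forall a, {within cmap a @` cdom a, continuous (cinv a)};
  chart_change : forall a b (j : 'I_n),
    holomorphic (cmap a @` (cdom a `&` cdom b))
                (fun z => cmap b (cinv a z) ord0 j)
}.

Definition holomorphic_on (R : realType) (n : nat) (X : complex_manifold R n)
    (W : set X) (f : X -> Cx R) : Prop :=
  forall a : chart X,
    holomorphic (cmap a @` (W `&` cdom a)) (fun z => f (cinv a z)).

Definition holomorphic_GL (R : realType) (n M : nat) (X : complex_manifold R n)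
    (W : set X) (h : X -> 'M[Cx R]_M) : Prop :=
  (forall r s, holomorphic_on W (fun x => h x r s)) /\
  (forall x, W x -> h x \in unitmx).

(** * Holomorphic vector bundles and full flags *)

Section Bundles.
Variables (R : realType) (n : nat) (X : complex_manifold R n) (M : nat).

(* phi o psi^-1 (x, v) = (x, h x v) over W *)
Definition transition_on (fib : X -> lmodType (Cx R)) (W : set X)
    (phi psi : forall x, fib x -> 'cV[Cx R]_M) (h : X -> 'M[Cx R]_M) : Prop :=
  forall x, W x -> forall v : fib x, phi x v = h x *m psi x v.

Definition fibrewise_iso (fib : X -> lmodType (Cx R)) (W : set X)
    (phi : forall x, fib x -> 'cV[Cx R]_M) : Prop :=
  forall x, W x -> linear (phi x) /\ bijective (phi x).

(* A holomorphic vector bundle of rank M, given by its fibres E_x and an atlas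
   of local trivializations E_x -> C^M with holomorphic transition functions;
   the complex structure on the total space is the one making these
   trivializations biholomorphic. *)
Record vector_bundle := VectorBundle {
  fibre : X -> lmodType (Cx R);
  triv : Type;
  tdom : triv -> set X;
  tmap : triv -> forall x, fibre x -> 'cV[Cx R]_M;
  tdom_open : forall t, open (tdom t);
  tdom_cover : forall x, exists t, tdom t x;
  tmap_iso : forall t, fibrewise_iso (tdom t) (tmap t);
  tmap_change : forall t s, exists2 h : X -> 'M[Cx R]_M,
    holomorphic_GL (tdom t `&` tdom s) h &
    transition_on (tdom t `&` tdom s) (tmap t) (tmap s) h
}.

Definition trivialization (E : vector_bundle) (W : set X)
    (phi : forall x, fibre E x -> 'cV[Cx R]_M) : Prop :=
  fibrewise_iso W phi /\
  forall t : triv E, exists2 h : X -> 'M[Cx R]_M,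
    holomorphic_GL (W `&` tdom t) h &
    transition_on (W `&` tdom t) phi (tmap t) h.

(* Over W, phi maps the family S of subsets of the fibres onto
   W x (C^p x 0). *)
Definition straightens (E : vector_bundle) (W : set X)
    (phi : forall x, fibre E x -> 'cV[Cx R]_M) (p : nat)
    (S : forall x, set (fibre E x)) : Prop :=
  forall x, W x -> forall v : fibre E x,
    S x v <-> forall r : 'I_M, (p <= r)%N -> phi x v r ord0 = 0.

Definition holomorphic_subbundle (E : vector_bundle) (p : nat)
    (S : forall x, set (fibre E x)) : Prop :=
  forall x, exists (W : set X) (phi : forall x, fibre E x -> 'cV[Cx R]_M),
    [/\ open W, W x, trivialization W phi & straightens W phi p S].

(* E_0 = 0, E_M = E, and E_p / E_(p-1) being a line bundle are consequences of
   rank E_p = p. *)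
Record full_flag (E : vector_bundle) := FullFlag {
  flag_step : nat -> forall x, set (fibre E x);
  flag_subbundle : forall p, (p <= M)%N ->
    holomorphic_subbundle p (flag_step p);
  flag_incl : forall p, (p < M)%N ->
    forall x (v : fibre E x), flag_step p v -> flag_step p.+1 v
}.

Record open_cover := OpenCover {
  cover_disp : Order.disp_t;
  cover_idx : orderType cover_disp;
  cover_set : cover_idx -> set X;
  cover_open : forall i, open (cover_set i);
  cover_full : forall x, exists i, cover_set i x
}.

Definition transition_system (E : vector_bundle) (F : full_flag E)
    (U : open_cover) (g : cover_idx U -> cover_idx U -> X -> 'M[Cx R]_M) :
    Prop :=
  exists phi : cover_idx U -> forall x, fibre E x -> 'cV[Cx R]_M,
    (forall i, trivialization (cover_set i) (phi i) /\
       forall p, (p <= M)%N ->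
         straightens (cover_set i) (phi i) p (flag_step F p)) /\
    (forall i j, transition_on (cover_set i `&` cover_set j)
                               (phi i) (phi j) (g i j)).

End Bundles.

(** * Differential forms *)

(* q-ary complex valued functions on C^n; alternating multilinearity is imposed
   in [closed_holomorphic_form]. *)
Definition altf (R : realType) (n q : nat) := ('I_q -> 'rV[Cx R]_n) -> Cx R.

Definition wedge (R : realType) (n p q : nat) (a : altf R n p) (b : altf R n q) :
    altf R n (p + q) := fun v =>
  (p`! * q`!)%:R^-1 * \sum_(s : 'S_(p + q))
    (-1) ^+ s * a (fun i => v (s (lshift q i)))
              * b (fun j => v (s (rshift p j))).

Definition wedge_mx (R : realType) (n M p q : nat)
    (A : 'M[altf R n p]_M) (B : 'M[altf R n q]_M) : 'M[altf R n (p + q)]_M :=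
  \matrix_(r, s) fun v => \sum_(m < M) wedge (A r m) (B m s) v.

(* A_0 A_1 ... A_(k-1), using that 1 + k computes to k.+1 *)
Fixpoint wedge_prod (R : realType) (n M k : nat) :
    ('I_k -> 'M[altf R n 1]_M) -> 'M[altf R n k]_M :=
  match k with
  | 0 => fun _ => \matrix_(r, s) fun _ => (r == s)%:R
  | k'.+1 => fun A =>
      wedge_mx (A ord0) (wedge_prod (fun l => A (lift ord0 l)))
  end.

Section Forms.
Variables (R : realType) (n : nat) (X : complex_manifold R n).

(* A form is given by its expression [w a x] at x in each chart a; only the
   values for x in the domain of a and in the open set under consideration
   matter. *)
Definition form (q : nat) := chart X -> X -> altf R n q.

Definition form_eq_on (q : nat) (W : set X) (w w' : form q) : Prop :=
  forall a x v, W x -> cdom a x -> w a x v = w' a x v.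

Definition exterior_d (q : nat) (w : form q) : form q.+1 := fun a x v =>
  \sum_(j < q.+1) (-1) ^+ j *
    'd (fun z => w a (cinv a z) (fun m => v (lift j m))) (cmap a x) (v j).

Record closed_holomorphic_form (q : nat) (W : set X) (w : form q) : Prop :=
  ClosedHolomorphicForm {
  form_multilinear : forall a x, W x -> cdom a x ->
    forall (v : 'I_q -> 'rV[Cx R]_n) (j : 'I_q) (c : Cx R) (u u' : 'rV[Cx R]_n),
      w a x (fun m => if m == j then c *: u + u' else v m) =
      c * w a x (fun m => if m == j then u else v m) +
      w a x (fun m => if m == j then u' else v m);
  form_alternating : forall a x, W x -> cdom a x ->
    forall (v : 'I_q -> 'rV[Cx R]_n) (i j : 'I_q),
      i != j -> v i = v j -> w a x v = 0;
  form_chart_change : forall a b x, W x -> cdom a x -> cdom b x ->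
    forall v : 'I_q -> 'rV[Cx R]_n,
      w a x v =
      w b x (fun m => 'd (fun z => cmap b (cinv a z)) (cmap a x) (v m));
  form_holomorphic : forall a (v : 'I_q -> 'rV[Cx R]_n),
    holomorphic (cmap a @` (W `&` cdom a)) (fun z => w a (cinv a z) v);
  form_closed : form_eq_on W (exterior_d w) (fun _ _ _ => 0)
}.

(** * Cech cohomology with coefficients in d Omega^(q-1)

   [closed_holomorphic_form q W], up to [form_eq_on W], is the group of
   sections over W of d Omega^(q-1), whose elements are forms of degree q. *)

Variable q : nat.

Definition increasing (d : Order.disp_t) (I : orderType d) (p : nat)
    (i : 'I_p -> I) : bool :=
  [forall a : 'I_p, forall b : 'I_p, (a < b)%N ==> (i a < i b)%O].

Definition cover_inter (U : open_cover X) (p : nat)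
    (i : 'I_p -> cover_idx U) : set X := [set x | forall m, cover_set (i m) x].

(* Only the values at increasing tuples are significant. *)
Definition cochain (U : open_cover X) (p : nat) :=
  ('I_p.+1 -> cover_idx U) -> form q.

Definition is_cochain (U : open_cover X) (p : nat) (c : cochain U p) : Prop :=
  forall i, increasing i -> closed_holomorphic_form (cover_inter i) (c i).

Definition cochain_eq (U : open_cover X) (p : nat) (c c' : cochain U p) : Prop :=
  forall i, increasing i -> form_eq_on (cover_inter i) (c i) (c' i).

Definition cech_d (U : open_cover X) (p : nat) (c : cochain U p) :
    cochain U p.+1 := fun i a x v =>
  \sum_(j < p.+2) (-1) ^+ j * c (fun m => i (lift j m)) a x v.

Definition cocycle (U : open_cover X) (p : nat) (c : cochain U p) : Prop :=
  is_cochain c /\ cochain_eq (cech_d c) (fun _ _ _ _ => 0).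

Definition coboundary (U : open_cover X) (p : nat) : cochain U p -> Prop :=
  match p with
  | 0 => fun c => cochain_eq c (fun _ _ _ _ => 0)
  | p'.+1 => fun c => exists2 b : cochain U p',
               is_cochain b & cochain_eq c (cech_d b)
  end.

Definition cohomology_class (U : open_cover X) (p : nat) (c : cochain U p) :
    set (cochain U p) :=
  [set c' | cocycle c' /\ coboundary (fun i a x v => c' i a x v - c i a x v)].

(* The cohomology H^p(U, d Omega^(q-1)) of the cover U. *)
Definition cover_cohomology (U : open_cover X) (p : nat) :=
  {h : set (cochain U p) | exists2 c, cocycle c & h = cohomology_class c}.

Definition to_cover_cohomology (U : open_cover X) (p : nat) (c : cochain U p)
    (hc : cocycle c) : cover_cohomology U p :=
  exist _ (cohomology_class c) (ex_intro2 _ _ c hc erefl).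

Definition refinement (U V : open_cover X)
    (r : cover_idx V -> cover_idx U) : Prop :=
  forall j, cover_set j `<=` cover_set (r j).

(* r need not preserve the orders: the value of c at the tuple r o j is that of
   the alternating extension of c, namely sgn s * c (r o j o s) if r o j o s is
   increasing, and 0 if r o j has a repetition. *)
Definition refine_cochain (U V : open_cover X) (p : nat)
    (r : cover_idx V -> cover_idx U) (c : cochain U p) : cochain V p :=
  fun j a x v => \sum_(s : 'S_p.+1 | increasing (fun m => r (j (s m))))
    (-1) ^+ s * c (fun m => r (j (s m))) a x v.

(* h' is the image of h under the map H^p(U) -> H^p(V) of some refinement. *)
Definition cohomology_refines (p : nat)
    (h h' : {U : open_cover X & cover_cohomology U p}) : Prop :=
  exists (r : cover_idx (projT1 h') -> cover_idx (projT1 h))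
         (c : cochain (projT1 h) p),
    [/\ refinement r, cocycle c, sval (projT2 h) = cohomology_class c &
        sval (projT2 h') = cohomology_class (refine_cochain r c)].

(* The direct limit of the H^p(U): the disjoint union modulo the equivalence
   relation generated by identifying a class with its images under
   refinement. *)
Definition limit_class (p : nat)
    (h : {U : open_cover X & cover_cohomology U p}) :
    {U : open_cover X & cover_cohomology U p} -> Prop :=
  clos_refl_sym_trans _ (@cohomology_refines p) h.

Definition cech_cohomology (p : nat) :=
  {A : {U : open_cover X & cover_cohomology U p} -> Prop |
    exists h, A = limit_class h}.

Definition to_cech_cohomology (U : open_cover X) (p : nat)
    (h : cover_cohomology U p) : cech_cohomology p :=
  exist _ (limit_class (existT _ U h)) (ex_intro _ (existT _ U h) erefl).

End Forms.

(** * The refined T invariants *)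

Section RefinedT.
Variables (R : realType) (n : nat) (X : complex_manifold R n) (M : nat).

(* h^-1 dh at x, in the chart a *)
Definition maurer_cartan (h : X -> 'M[Cx R]_M) (a : chart X) (x : X) :
    'M[altf R n 1]_M :=
  \matrix_(r, s) fun v =>
    (invmx (h x) *m
     \matrix_(r', s') 'd (fun z => h (cinv a z) r' s') (cmap a x) (v ord0)) r s.

Definition refined_T_cochain (U : open_cover X)
    (g : cover_idx U -> cover_idx U -> X -> 'M[Cx R]_M) (k : nat) :
    cochain k U k := fun i a x v =>
  \sum_(s : 'S_k.+1) (-1) ^+ s / (k.+1)`!%:R *
    \sum_(m < M) wedge_prod
      (fun l : 'I_k => maurer_cartan
         (g (i (s (widen_ord (leqnSn k) l))) (i (s ord_max))) a x) m m v.

End RefinedT.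

Arguments refined_T_cochain {R n X M U} g k.

(* The k-th refined T invariant f_k^r computed from U and g. *)
Definition refined_T_invariant (R : realType) (n : nat)
    (X : complex_manifold R n) (M : nat) (U : open_cover X)
    (g : cover_idx U -> cover_idx U -> X -> 'M[Cx R]_M) (k : nat)
    (hc : cocycle (refined_T_cochain g k)) : cech_cohomology X k k :=
  to_cech_cohomology (to_cover_cohomology hc).

(* Main.v *)
(** The transition matrices are upper triangular, so the trace of a product of
    matrices [g^-1 dg] is the sum over the diagonal positions [m] of a wedge
    product of the 1-forms [dlog (g_ij)_mm].  For fixed [m] these 1-forms are
    closed and additive, [dlog u_ij + dlog u_jk = dlog u_ik]; writing them as
    differences [y_i - y_j], each term of the antisymmetrized sum evaluated on
    [v] becomes the determinant of the matrix [(y_i(v_c) | 1)].  The cocycle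
    relation is the expansion of a determinant with two equal columns of ones.

    Independence needs no explicit coboundary: trivializations over two covers
    [U] and [U'] together form one over the disjoint union of the covers, with
    the indices of [U] placed before those of [U'], and the cocycle of the union
    restricts to the two given ones under the refinements [U] and [U']. *)
From HB Require Import structures.
Require Import Defs.
From Stdlib Require Import Relation_Operators.
From mathcomp Require Import all_boot all_order all_algebra all_fingroup.
From mathcomp Require Import complex.
From mathcomp Require Import all_classical all_reals all_analysis ring.
Set Implicit Arguments.
Unset Strict Implicit.
Unset Printing Implicit Defensive.
Import Order.TTheory GRing.Theory Num.Theory numFieldNormedType.Exports.
Local Open Scope ring_scope.
Local Open Scope classical_set_scope.

(** * Alternating sums and wedge products as determinants *)

(** A permutation is determined by the image [j] of [ord0] and by the permutation it induces between
    the complements of [ord0] and [j]; injectivity of this encoding and [(n+1)! = (n+1) n!] give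
    bijectivity. *)
Lemma sum_lift_perm (V : nmodType) (n : nat) (F : 'S_n.+1 -> V) :
  \sum_s F s = \sum_j \sum_(t : 'S_n) F (lift_perm ord0 j t).
Proof.
rewrite pair_big /=; apply: reindex => /=.
apply: onW_bij; apply: inj_card_bij => [[j t] [j' t'] /= e|]; last first.
  by rewrite card_prod !card_Sn card_ord factS.
have ej : j = j' by rewrite -(lift_perm_id ord0 j t) e lift_perm_id.
rewrite -{}ej in e *; congr pair; apply/permP => c.
by apply: (@lift_inj _ j); rewrite -!(lift_perm_lift ord0) e.
Qed.

Lemma sign_lift_perm (R : pzRingType) (n : nat) (j : 'I_n.+1) (t : 'S_n) :
  (-1) ^+ lift_perm ord0 j t = (-1) ^+ j * (-1) ^+ t :> R.
Proof. by rewrite odd_lift_perm /= signr_addb signr_odd. Qed.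

Lemma det_col_perm (R : comPzRingType) (n : nat) (t : 'S_n) (A : 'M[R]_n) :
  \det (col_perm t A) = (-1) ^+ t * \det A.
Proof. by rewrite col_permE det_mulmx det_perm odd_permV mulrC. Qed.

Lemma det_row_perm (R : comPzRingType) (n : nat) (t : 'S_n) (A : 'M[R]_n) :
  \det (row_perm t A) = (-1) ^+ t * \det A.
Proof. by rewrite row_permE det_mulmx det_perm. Qed.

(* One expansion of [d (a_0 /\ ... /\ a_(k-1)) = 0]: [S] stands for the
   derivative of the [l]-th factor, whose symmetry is [d a_l = 0]. *)
Lemma alternating_sum_symmetric (R : numDomainType) (k : nat)
    (A : 'I_k -> 'I_k.+1 -> R) (S : 'I_k.+1 -> 'I_k.+1 -> R) (l : 'I_k) :
  (forall c c', S c c' = S c' c) ->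
  \sum_(j < k.+1) (-1) ^+ j *
     (\sum_(t : 'S_k) (-1) ^+ t * (S j (lift j (t l)) *
        \prod_(m < k | m != l) A m (lift j (t m)))) = 0.
Proof.
move=> symS.
pose F (s : 'S_k.+1) : R := S (s ord0) (s (lift ord0 l)) *
  \prod_(m < k | m != l) A m (s (lift ord0 m)).
transitivity (\sum_(s : 'S_k.+1) (-1) ^+ s * F s).
  rewrite sum_lift_perm; apply: eq_bigr => j _; rewrite mulr_sumr.
  apply: eq_bigr => t _; rewrite sign_lift_perm /F lift_perm_id lift_perm_lift.
  rewrite mulrA; congr (_ * (_ * _)).
  by apply: eq_bigr => m _; rewrite lift_perm_lift.
set X := (X in X = _); suff /eqP : X = - X.
  by rewrite -addr_eq0 -mulr2n mulrn_eq0 /= => /eqP.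
(* Precomposing [s] with this transposition swaps the two arguments of [S], leaves the product alone
   because [m != l], and reverses the sign; so the sum is its own negative. *)
pose p := tperm ord0 (lift ord0 l).
rewrite {1}/X (reindex_inj (mulgI p)) /X -sumrN; apply: eq_bigr => s _.
rewrite odd_permM odd_tperm neq_lift /= -(addTb (odd_perm s)) signr_addb mulN1r.
rewrite mulNr; congr (- (_ * _)); rewrite /F !permM tpermL tpermR symS.
congr (_ * _); apply: eq_bigr => m ml; rewrite permM tpermD ?neq_lift //.
by rewrite (inj_eq (@lift_inj _ _)) eq_sym.
Qed.

Section CechAlgebra.
Variables (C : fieldType) (k : nat).

(** The points [y r] in affine coordinates, one per row, with ones in the last column. As for the
    volume of a simplex, the determinant is alternating in the points and depends only on their
    differences. *)
Definition augment (y : 'I_k.+1 -> 'I_k -> C) : 'M[C]_k.+1 :=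
  \matrix_(r, c) if unlift ord_max c is Some c' then y r c' else 1.

(* Column operations clear the last row of [augment y]. *)
Lemma det_augment (y : 'I_k.+1 -> 'I_k -> C) :
  \det (augment y) =
  \det (\matrix_(l < k, c < k) (y (widen_ord (leqnSn k) l) c - y ord_max c)).
Proof.
(* Multiplication on the right by this unipotent lower triangular matrix subtracts [y ord_max c']
   times the column of ones from each other column [c']. *)
pose B : 'M[C]_k.+1 := \matrix_(r, c)
  ((r == c)%:R - if r == ord_max then
                   if unlift ord_max c is Some c' then y ord_max c' else 0
                 else 0).
have detB : \det B = 1.
  rewrite det_trig; last first.
    apply/is_trig_mxP => i j ij; rewrite mxE.
    have -> : (i == j) = false by apply/negbTE; rewrite neq_ltn ij.
    case: eqP ij => [->|_ _]; last by rewrite subr0.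
    by rewrite ltnNge -ltnS ltn_ord.
  apply: big1 => i _; rewrite mxE eqxx.
  by case: eqP => [->|_]; rewrite ?unlift_none subr0.
rewrite -[LHS]mulr1 -detB -det_mulmx (expand_det_row _ ord_max).
have PE r c : (augment y *m B) r c =
    if unlift ord_max c is Some c' then y r c' - y ord_max c' else 1.
  rewrite mxE (eq_bigr (fun x => augment y r x * (x == c)%:R -
     (if x == ord_max then augment y r x *
                   if unlift ord_max c is Some c' then y ord_max c' else 0
                 else 0))); last first.
    by move=> x _; rewrite [B _ _]mxE mulrBr; case: ifP; rewrite ?mulr0.
  rewrite sumrB (bigD1 c) //= eqxx mulr1 big1 => [|x /negbTE ->]; last first.
    by rewrite mulr0.
  rewrite -big_mkcond big_pred1_eq !mxE unlift_none addr0.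
  by case: unliftP => [c' _|_]; rewrite mul1r // subr0.
rewrite (bigD1 ord_max) //= big1 => [|c cm]; last first.
  rewrite PE; case: unliftP cm => [c' ->|->]; last by rewrite eqxx.
  by rewrite subrr mul0r.
rewrite PE unlift_none mul1r addr0 /cofactor -signr_odd addnn odd_double mul1r.
congr determinant; apply/matrixP => l c.
rewrite [LHS]mxE [LHS]mxE PE liftK [RHS]mxE.
by congr (y _ _ - _); apply: val_inj; rewrite /= /bump leqNgt ltn_ord.
Qed.

(** Passing to [augment] turns the choice of base point and the order of the differences into a
    plain row permutation. All terms of an antisymmetrized sum thus become equal. *)
Lemma det_diff_perm (y : 'I_k.+1 -> 'I_k -> C) (s : 'S_k.+1) :
  \det (\matrix_(l < k, c < k) (y (s (widen_ord (leqnSn k) l)) c -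
                                y (s ord_max) c)) =
  (-1) ^+ s * \det (augment y).
Proof.
rewrite -(det_augment (fun i => y (s i))) -det_row_perm; congr determinant.
by apply/matrixP => r c; rewrite !mxE.
Qed.

Lemma alternating_sum_augment (y : 'I_k.+2 -> 'I_k -> C) :
  \sum_(j < k.+2) (-1) ^+ j * \det (augment (fun i => y (lift j i))) = 0.
Proof.
(* The first and the last column consist of ones. Deleting row [j] and the first column leaves the
   augmented matrix of the points other than [j]. *)
pose B : 'M[C]_k.+2 := \matrix_(r, c)
  if unlift ord0 c is Some c' then
    if unlift ord_max c' is Some c'' then y r c'' else 1
  else 1.
rewrite -[RHS](_ : \det B = 0).
  rewrite (expand_det_col _ ord0); apply: eq_bigr => j _.
  rewrite mxE unlift_none mul1r /cofactor addn0; congr (_ * \det _).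
  by apply/matrixP => r c; rewrite !mxE liftK.
rewrite -det_tr (@determinant_alternate _ _ _ ord0 (lift ord0 ord_max)) //.
by move=> r; rewrite !mxE unlift_none liftK unlift_none.
Qed.

End CechAlgebra.

Section WedgeAlgebra.
Variables (R : realType) (n : nat).

(** Laplace expansion along the first row. The permutations are grouped by the argument [v j] given
    to [alpha]; in each group the [q!] terms coincide, their sign cancelling that of the permuted
    columns, and this absorbs the factor [1 / (1! q!)]. *)
Lemma wedge1_det (q : nat) (alpha : 'rV[Cx R]_n -> Cx R)
    (beta : 'I_q -> 'rV[Cx R]_n -> Cx R) (v : 'I_(1 + q) -> 'rV[Cx R]_n) :
  wedge (fun w : 'I_1 -> _ => alpha (w ord0))
        (fun w => \det (\matrix_(l, c) beta l (w c))) v =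
  \det (\matrix_(l < 1 + q, c < 1 + q)
    if unlift ord0 l is Some l' then beta l' (v c) else alpha (v c)).
Proof.
rewrite /wedge (expand_det_row _ ord0).
have -> : forall F : 'S_(1 + q) -> Cx R, \sum_s F s =
    \sum_j \sum_(t : 'S_q) F (lift_perm ord0 j t) by exact: sum_lift_perm.
rewrite mulr_sumr; apply: eq_bigr => j _.
rewrite (eq_bigr (fun _ => (-1) ^+ j * alpha (v j) *
   \det (\matrix_(l, c) beta l (v (lift j c))))) => [|t _]; last first.
  rewrite sign_lift_perm.
  have -> : lshift q (ord0 : 'I_1) = ord0 by apply: val_inj.
  rewrite lift_perm_id.
  have -> : \matrix_(l, c) beta l (v (lift_perm ord0 j t (rshift 1 c))) =
            col_perm t (\matrix_(l, c) beta l (v (lift j c))).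
    apply/matrixP => l c; rewrite !mxE.
    have -> : rshift 1 c = lift ord0 c by apply: val_inj.
    by rewrite lift_perm_lift.
  rewrite det_col_perm -[in RHS](mul1r (\det _)) -[X in X * \det _](sqrr_sign _ t).
  by rewrite expr2 -!mulrA; congr (_ * _); rewrite mulrCA.

rewrite sumr_const card_Sn mul1n -[X in _ * X = _]mulr_natl mulKf; last first.
  by rewrite pnatr_eq0 -lt0n fact_gt0.
rewrite mxE unlift_none /cofactor add0n mulrA.
rewrite [alpha _ * _]mulrC; congr (_ * \det _).
by apply/matrixP => l c; rewrite !mxE liftK.
Qed.

Lemma wedge_eq0l (p q : nat) (a : altf R n p) (b : altf R n q) v :
  (forall w, a w = 0) -> wedge a b v = 0.
Proof. by move=> a0; rewrite /wedge big1 ?mulr0 // => s _; rewrite a0 mulr0 mul0r. Qed.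

Lemma wedge_eq0r (p q : nat) (a : altf R n p) (b : altf R n q) v :
  (forall w, b w = 0) -> wedge a b v = 0.
Proof. by move=> b0; rewrite /wedge big1 ?mulr0 // => s _; rewrite b0 mulr0. Qed.

(** In the sum over [m] of [A r m] wedge [B m s], a term with [m < r] or [s < m] vanishes. Nothing
    survives when [s < r], and only [m = r] when [s = r], so the diagonal entries multiply among
    themselves. The induction needs both conclusions together. *)
Lemma wedge_prod_trig (M k : nat)
    (A : 'I_k -> 'M[altf R n 1]_M) (alpha : 'I_M -> 'I_k -> 'rV[Cx R]_n -> Cx R) :
  (forall l (r s : 'I_M) w, (s < r)%N -> A l r s w = 0) ->
  (forall l r w, A l r r w = alpha r l (w ord0)) ->
  (forall (r s : 'I_M) w, (s < r)%N -> wedge_prod A r s w = 0) /\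
  (forall r w, wedge_prod A r r w = \det (\matrix_(l, c) alpha r l (w c))).
Proof.
elim: k A alpha => [|k IH] A alpha A0 AE.
  split=> [r s w sr|r w]; rewrite /= mxE ?eqxx ?det_mx00 //.
  by rewrite -val_eqE /= gtn_eqF.
have [P0 PE] := IH (fun l => A (lift ord0 l)) (fun r l => alpha r (lift ord0 l))
  (fun l => A0 _) (fun l => AE _).
split=> [r s w sr|r w] /=; rewrite mxE.
  apply: big1 => m _; have [mr|rm] := ltnP m r.
    by apply: wedge_eq0l => w'; exact: A0.
  by apply: wedge_eq0r => w'; apply: P0; exact: leq_trans rm.
rewrite (bigD1 r) //= big1 ?addr0 => [|m mr]; last first.
  have [mr'|rm] := ltnP m r; first by apply: wedge_eq0l => w'; exact: A0.
  apply: wedge_eq0r => w'; apply: P0; rewrite ltn_neqAle rm andbT.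
  by rewrite eq_sym.
have -> : A ord0 r r = (fun w => alpha r ord0 (w ord0)).
  by apply: funext => w'; exact: AE.
have -> : wedge_prod (fun l => A (lift ord0 l)) r r =
    (fun w => \det (\matrix_(l, c) alpha r (lift ord0 l) (w c))).
  by apply: funext => w'; exact: PE.
rewrite [LHS](wedge1_det (alpha r ord0) (fun l => alpha r (lift ord0 l))).
congr determinant; apply/matrixP => l c; rewrite !mxE.
by case: unliftP => [l' ->|->].
Qed.

End WedgeAlgebra.

(** * Holomorphic functions *)

Section LocalDifferentials.
Variables (K : numFieldType) (V W : normedModType K).

(** A first order expansion of [f] at [x] is also one of [g], and such expansions are unique. This
    transfers differentials of total functions along identities valid only on an open set. *)
Lemma near_eq_differentiable (f g : V -> W) (x : V) :
  (\forall y \near x, f y = g y) -> differentiable f x ->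
  differentiable g x /\ 'd g x = 'd f x :> (V -> W).
Proof.
move=> fg df.
have fgx : f x = g x by exact: nbhs_singleton fg.
have dc := diff_continuous df.
have E : g \o shift x = cst (g x) + 'd f x +o_ 0 id.
  apply/eqaddoP => e e0.
  have /eqaddoP /(_ e e0) := diff_locally df.
  have : \forall y \near (0 : V), f (y + x) = g (y + x).
    by move: fg; rewrite (near_shift 0) subr0.
  apply: filterS2 => y; rewrite /= => fgy.
  by rewrite !fctE /= fgy fgx.
have dgE := diff_unique dc E.
split=> //; apply/diff_locallyP; rewrite dgE; split=> //.
Qed.

End LocalDifferentials.

Section HolomorphicClosure.
Variables (R : realType) (n : nat).
Local Notation C := (Cx R).
Local Notation V := 'rV[C]_n.
Implicit Types (D : set V) (f g : V -> C).

Lemma cdiff_upto_sub (m : nat) D D' f :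
  D' `<=` D -> cdifferentiable_upto m D f -> cdifferentiable_upto m D' f.
Proof.
move=> sD; elim: m f => [|m IH] f [fd f'].
  by split=> [z /sD Dz|]; [exact: fd|].
by split=> [z /sD Dz|v]; [exact: fd|exact: IH (f' v)].
Qed.

Lemma cdiff_uptoW (m : nat) D f :
  cdifferentiable_upto m.+1 D f -> cdifferentiable_upto m D f.
Proof.
by elim: m f => [|m IH] f [fd f'] /=; split=> // v; apply: IH; exact: f'.
Qed.

Lemma cdiff_upto_eq (m : nat) D f g : open D -> (forall z, D z -> f z = g z) ->
  cdifferentiable_upto m D f -> cdifferentiable_upto m D g.
Proof.
move=> oD; elim: m f g => [|m IH] f g fg [fd f'].
  split=> // z Dz; apply: (proj1 (@near_eq_differentiable C V C f g z _ (fd z Dz))).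
  apply: filterS (open_nbhs_nbhs (conj oD Dz)) => y Dy; exact: fg.
have E z (Dz : D z) : differentiable g z /\ 'd g z = 'd f z :> (V -> C).
  apply: (@near_eq_differentiable C V C f g z _ (fd z Dz)).
  apply: filterS (open_nbhs_nbhs (conj oD Dz)) => y Dy; exact: fg.
split=> [z Dz|v].
  exact: (E z Dz).1.
apply: IH (f' v) => z Dz.
exact: esym (congr1 (fun h => h v) (E z Dz).2).
Qed.

Lemma cdiff_upto_local (m : nat) D f :
  (forall z, D z -> exists2 D', open D' /\ D' z & cdifferentiable_upto m D' f) ->
  cdifferentiable_upto m D f.
Proof.
elim: m f => [|m IH] f H.
  by split=> [z /H[D' [oD' D'z] [fd _]]|]; [exact: fd|].
split=> [z /H[D' [oD' D'z] [fd _]]|v]; first exact: fd.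
by apply: IH => z /H[D' D'z [_ f']]; exists D'; [|exact: f'].
Qed.

Lemma cdiff_upto_cst (m : nat) D (c : C) : cdifferentiable_upto m D (fun _ => c).
Proof.
elim: m c => [|m IH] c;
  (split; first by move=> z _; exact: (@differentiable_cst C V C c z)).
  by [].
move=> v; rewrite [X in cdifferentiable_upto _ _ X](_ : _ = fun _ => 0); first exact: IH.
apply: funext => z; exact: (congr1 (fun h => h v) (@diff_cst C V C c z)).
Qed.

Lemma cdiff_uptoD (m : nat) D f g : open D -> cdifferentiable_upto m D f ->
  cdifferentiable_upto m D g -> cdifferentiable_upto m D (fun z => f z + g z).
Proof.
move=> oD; elim: m f g => [|m IH] f g [fd f'] [gd g'];
  (split; first by move=> z Dz;
     exact: (@differentiableD C V C f g z (fd z Dz) (gd z Dz))).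
  by [].
move=> v; apply: (cdiff_upto_eq oD) (IH _ _ (f' v) (g' v)) => z Dz.
exact: esym (congr1 (fun h => h v) (@diffD C V C f g z (fd z Dz) (gd z Dz))).
Qed.

Lemma cdiff_uptoM (m : nat) D f g : open D -> cdifferentiable_upto m D f ->
  cdifferentiable_upto m D g -> cdifferentiable_upto m D (fun z => f z * g z).
Proof.
move=> oD; elim: m f g => [|m IH] f g cf cg.
  split; last by [].
  by move=> z Dz; exact: (@differentiableM C V f g z (cf.1 z Dz) (cg.1 z Dz)).
have [fd f'] := cf; have [gd g'] := cg.
split=> [z Dz|v]; first exact: (@differentiableM C V f g z (fd z Dz) (gd z Dz)).
apply: (@cdiff_upto_eq _ _ (fun z => f z * 'd g z v + g z * 'd f z v) _ oD).
  move=> z Dz; apply: esym.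
  exact: (congr1 (fun h => h v) (@diffM C V f g z (fd z Dz) (gd z Dz))).
(* The Leibniz rule keeps one factor undifferentiated; its order is lowered by one to match the
   derivative of the other. *)
exact: cdiff_uptoD oD (IH _ _ (cdiff_uptoW cf) (g' v)) (IH _ _ (cdiff_uptoW cg) (f' v)).
Qed.

Lemma cdiff_uptoV (m : nat) D f : open D -> (forall z, D z -> f z != 0) ->
  cdifferentiable_upto m D f -> cdifferentiable_upto m D (fun z => (f z)^-1).
Proof.
move=> oD f0; elim: m => [|m IH] cf.
  split; last by [].
  by move=> z Dz; exact: (@differentiableV C V f z (cf.1 z Dz) (f0 z Dz)).
have [fd f'] := cf; have cV := IH (cdiff_uptoW cf).
split=> [z Dz|v]; first exact: (@differentiableV C V f z (fd z Dz) (f0 z Dz)).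
(* The derivative of [1 / f] is a product of [1 / f], already regular to order [m] by induction, and
   a derivative of [f]. *)
apply: (@cdiff_upto_eq _ _ (fun z => -1 * ((f z)^-1 * (f z)^-1) * 'd f z v) _ oD).
  move=> z Dz; apply: esym.
  apply: (etrans (congr1 (fun h => h v) (@diffV C V f z (fd z Dz) (f0 z Dz)))).
  by rewrite mulN1r -invfM -expr2.
exact: cdiff_uptoM oD (cdiff_uptoM oD (cdiff_upto_cst _ _ _)
  (cdiff_uptoM oD cV cV)) (f' v).
Qed.

Lemma holomorphic_sub D D' f : D' `<=` D -> holomorphic D f -> holomorphic D' f.
Proof. by move=> sD hf m; exact: cdiff_upto_sub (hf m). Qed.

Lemma holomorphic_eq D f g : open D -> (forall z, D z -> f z = g z) ->
  holomorphic D f -> holomorphic D g.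
Proof. by move=> oD fg hf m; exact: cdiff_upto_eq (hf m). Qed.

Lemma holomorphic_local D f :
  (forall z, D z -> exists2 D', open D' /\ D' z & holomorphic D' f) ->
  holomorphic D f.
Proof.
by move=> H m; apply: cdiff_upto_local => z /H[D' D'z hf]; exists D'.
Qed.

Lemma holomorphic_diff D f v : holomorphic D f -> holomorphic D (fun z => 'd f z v).
Proof. by move=> hf m; exact: (hf m.+1).2. Qed.

Lemma holomorphic_differentiable D f z : holomorphic D f -> D z ->
  differentiable f z.
Proof. by move=> hf; exact: (hf 0).1. Qed.

Lemma holomorphic_cst D (c : C) : holomorphic D (fun _ => c).
Proof. by move=> m; exact: cdiff_upto_cst. Qed.

Lemma holomorphicD D f g : open D -> holomorphic D f -> holomorphic D g ->
  holomorphic D (fun z => f z + g z).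
Proof. by move=> oD hf hg m; apply: cdiff_uptoD. Qed.

Lemma holomorphicM D f g : open D -> holomorphic D f -> holomorphic D g ->
  holomorphic D (fun z => f z * g z).
Proof. by move=> oD hf hg m; apply: cdiff_uptoM. Qed.

Lemma holomorphicV D f : open D -> (forall z, D z -> f z != 0) ->
  holomorphic D f -> holomorphic D (fun z => (f z)^-1).
Proof. by move=> oD f0 hf m; apply: cdiff_uptoV. Qed.

Lemma holomorphic_sum (I : Type) (r : seq I) (P : pred I) D (F : I -> V -> C) :
  open D -> (forall i, P i -> holomorphic D (F i)) ->
  holomorphic D (fun z => \sum_(i <- r | P i) F i z).
Proof.
move=> oD hF; elim: r => [|i r IH].
  by apply: holomorphic_eq oD _ (holomorphic_cst D 0) => z _; rewrite big_nil.
have [Pi|Pi] := boolP (P i); last first.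
  by apply: holomorphic_eq oD _ IH => z _; rewrite big_cons (negbTE Pi).
apply: holomorphic_eq oD _ (holomorphicD oD (hF i Pi) IH) => z _.
by rewrite big_cons Pi.
Qed.

Lemma holomorphic_prod (I : Type) (r : seq I) (P : pred I) D (F : I -> V -> C) :
  open D -> (forall i, P i -> holomorphic D (F i)) ->
  holomorphic D (fun z => \prod_(i <- r | P i) F i z).
Proof.
move=> oD hF; elim: r => [|i r IH].
  by apply: holomorphic_eq oD _ (holomorphic_cst D 1) => z _; rewrite big_nil.
have [Pi|Pi] := boolP (P i); last first.
  by apply: holomorphic_eq oD _ IH => z _; rewrite big_cons (negbTE Pi).
apply: holomorphic_eq oD _ (holomorphicM oD (hF i Pi) IH) => z _.
by rewrite big_cons Pi.
Qed.

Lemma holomorphic_det (m : nat) D (A : V -> 'M[C]_m) : open D ->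
  (forall r s, holomorphic D (fun z => A z r s)) ->
  holomorphic D (fun z => \det (A z)).
Proof.
move=> oD hA; apply: holomorphic_sum => // s _.
apply: holomorphicM => //; first exact: holomorphic_cst.
exact: holomorphic_prod.
Qed.

(** By Cramer's rule the entries of the inverse are cofactors divided by the determinant. *)
Lemma holomorphic_invmx (m : nat) D (A : V -> 'M[C]_m) : open D ->
  (forall r s, holomorphic D (fun z => A z r s)) ->
  (forall z, D z -> A z \in unitmx) ->
  forall r s, holomorphic D (fun z => invmx (A z) r s).
Proof.
move=> oD hA uA r s.
have hdet := holomorphic_det oD hA.
have hcof : holomorphic D (fun z => \det (row' s (col' r (A z)))).
  apply: holomorphic_det => // i j.
  by apply: holomorphic_eq oD _ (hA (lift s i) (lift r j)) => z _; rewrite !mxE.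
have hV : holomorphic D (fun z => (\det (A z))^-1).
  by apply: holomorphicV oD _ hdet => z /uA; rewrite unitmxE unitfE.
apply: holomorphic_eq oD _ (holomorphicM oD hV
  (holomorphicM oD (holomorphic_cst D ((-1) ^+ (s + r))) hcof)) => z Dz.
by rewrite /invmx uA // !mxE.
Qed.

End HolomorphicClosure.

(** * Symmetry of second differentials *)

Section Schwarz.
Variables (R : realType) (n : nat).
Local Notation C := (Cx R).
Local Notation V := 'rV[C]_n.
Local Notation rc := (real_complex R : R -> C).
Local Notation re := (@complex.Re R : C -> R).

(** Positivity in the partial order of the complex numbers forces the imaginary part to vanish;
    radii and error bounds over [C] can therefore be read in [R]. *)
Lemma gt0_CxP (d : C) : 0 < d -> exists2 e : R, 0 < e & d = rc e.
Proof.
case: d => a b; rewrite ltcE /= => /andP[/eqP -> a0]; by exists a.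
Qed.

Lemma norm_rc (x : R) : `|rc x| = rc `|x|.
Proof.
by rewrite normc_def /= expr0n /= addr0 sqrtr_sqr.
Qed.

Lemma re_le_norm (z : C) : rc `|re z| <= `|z|.
Proof.
rewrite normc_def lecR; case: z => a b /=.
by rewrite -[`|a|]sqrtr_sqr ler_sqrt ?lerDl ?sqr_ge0 // addr_ge0 // sqr_ge0.
Qed.

Lemma reB (z w : C) : re (z - w) = re z - re w.
Proof. by case: z w => [a b] [c d]. Qed.

Lemma re_rcM (x : R) (z : C) : re (rc x * z) = x * re z.
Proof. by case: z => a b; rewrite /= mul0r subr0. Qed.

Lemma near0_rc (P : C -> Prop) : (\forall h \near (0 : C)^', P h) ->
  \forall h \near (0 : R)^', P (rc h).
Proof.
move=> /nbhs_ballP[d /= /gt0_CxP[e e0 ->] dP]; apply/nbhs_ballP; exists e => //= h.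
rewrite -ball_normE /= sub0r normrN => he h0; apply: dP.
  by rewrite -ball_normE /= sub0r normrN norm_rc ltcR.
by apply: contra_neq h0 => /(congr1 re).
Qed.

(** The complex difference quotient is restricted to real increments; its real part converges
    because [|Re z| <= |z|]. *)
Lemma is_derive_re_line (f : V -> C) (z u : V) (x0 : R) :
  differentiable f (z + rc x0 *: u) ->
  is_derive x0 1 (fun x : R => re (f (z + rc x *: u)))
    (re ('d f (z + rc x0 *: u) u)).
Proof.
set a := z + rc x0 *: u => df.
have cv : (fun h : R => h^-1 *: (re (f (z + rc (h *: 1 + x0) *: u)) - re (f a)))
    @ 0^' --> re ('d f a u).
  apply/cvgrPdist_lt => e e0.
  have : (fun h : C => h^-1 *: (f (h *: u + a) - f a)) @ 0^' --> 'd f a u.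
    rewrite -(deriveE u df).
    exact: (@diff_derivable C V C f a u df).
  move=> /cvgrPdist_lt /(_ (rc e)); rewrite ltcR => /(_ e0) /near0_rc.
  apply: filterS => h; rewrite -ltcR; apply: le_lt_trans.
  apply: le_trans (re_le_norm _); rewrite lecR le_eqVlt; apply/orP; left.
  apply/eqP; congr `|_|; rewrite reB; congr (_ - _).
  rewrite -[_ *: (_ - _)]/(_ * (_ - _)) -[_ *: (_ - _)]/(_ * (_ - _)).
  rewrite -fmorphV re_rcM reB; congr (_ * (re (f _) - _)).
  by rewrite /a -[h *: 1]/(h * 1) mulr1 rmorphD scalerDl addrCA.
have E : 'D_1 (fun x : R => re (f (z + rc x *: u))) x0 = re ('d f a u).
  exact: cvg_lim cv.
by apply: DeriveDef => //; apply/cvg_ex; exists (re ('d f a u)).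
Qed.

(* Only real parameters along [u] and [v] are used, so that the real mean value
   theorem applies to the real part of [f]. *)
Lemma mean_value_box (D : set V) (f : V -> C) (z u v : V) (s : R) :
  cdifferentiable_upto 1 D f -> 0 < s ->
  (forall x y : R, 0 <= x <= s -> 0 <= y <= s -> D (z + rc x *: u + rc y *: v)) ->
  exists x y : R, [/\ 0 <= x <= s, 0 <= y <= s &
    re (f (z + rc s *: u + rc s *: v)) - re (f (z + rc s *: u)) -
    (re (f (z + rc s *: v)) - re (f z)) =
    re ('d (fun w => 'd f w u) (z + rc x *: u + rc y *: v) v) * s * s].
Proof.
move=> [fd f'] s0 DP.
have [fu _] := f' u.
have ss : 0 <= s <= s by rewrite ltW //=.
have s00 : 0 <= (0 : R) <= s by rewrite lexx ltW.
pose G (x : R) := re (f ((z + rc s *: v) + rc x *: u)) - re (f (z + rc x *: u)).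
have dG (x : R) : 0 <= x <= s -> is_derive x 1 G
   (re ('d f (z + rc s *: v + rc x *: u) u) - re ('d f (z + rc x *: u) u)).
  move=> xs; apply: is_deriveB; apply: is_derive_re_line; apply: fd.
    by rewrite addrAC; exact: DP.
  by have := DP x 0 xs s00; rewrite rmorph0 scale0r addr0.
have [||x xs GE] := MVT s0 (f := G) (df := fun x =>
   re ('d f (z + rc s *: v + rc x *: u) u) - re ('d f (z + rc x *: u) u)).
- by move=> x; rewrite in_itv /= => /andP[/ltW x0 /ltW xs]; apply: dG; rewrite x0.
- apply: derivable_within_continuous => x; rewrite in_itv /= => xs.
  by have [] := dG x xs.
have {}xs : 0 <= x <= s.
  by move: xs; rewrite in_itv /= => /andP[/ltW -> /ltW ->].
pose H (y : R) := re ('d f ((z + rc x *: u) + rc y *: v) u).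
have dH (y : R) : 0 <= y <= s -> is_derive y 1 H
    (re ('d (fun w => 'd f w u) (z + rc x *: u + rc y *: v) v)).
  move=> ys; apply: (@is_derive_re_line (fun w => 'd f w u)); apply: fu.
  exact: DP.
have [||y ys HE] := MVT s0 (f := H) (df := fun y =>
    re ('d (fun w => 'd f w u) (z + rc x *: u + rc y *: v) v)).
- by move=> y; rewrite in_itv /= => /andP[/ltW y0 /ltW ys]; apply: dH; rewrite y0.
- apply: derivable_within_continuous => y; rewrite in_itv /= => ys.
  by have [] := dH y ys.
have {}ys : 0 <= y <= s.
  by move: ys; rewrite in_itv /= => /andP[/ltW -> /ltW ->].
exists x, y; split=> //.
have G0 : G 0 = re (f (z + rc s *: v)) - re (f z).
  by rewrite /G rmorph0 scale0r !addr0.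
have Gs : G s = re (f (z + rc s *: u + rc s *: v)) - re (f (z + rc s *: u)).
  by rewrite /G addrAC.
have H0 : H 0 = re ('d f (z + rc x *: u) u).
  by apply: (congr1 (fun w => re ('d f w u))); rewrite rmorph0 scale0r addr0.
have Hs : H s = re ('d f (z + rc s *: v + rc x *: u) u).
  by apply: (congr1 (fun w => re ('d f w u))); rewrite addrAC.
rewrite -G0 -Gs GE subr0; apply: (congr1 (fun a => a * s)).
apply: etrans (esym (congr2 (fun a b => a - b) Hs H0)) _.
by apply: etrans HE _; apply: congr1; rewrite subr0.
Qed.

Lemma near_box (P : V -> Prop) (z u v : V) : (\forall w \near z, P w) ->
  exists2 s : R, 0 < s & forall x y : R, 0 <= x <= s -> 0 <= y <= s ->
    P (z + rc x *: u + rc y *: v).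
Proof.
move=> /nbhs_ballP[d /= d0 dP].
(* The summand 1 keeps the divisor positive when [u] and [v] vanish, and makes the final inequality
   strict. *)
have N0 : 0 < `|u| + `|v| + 1 by rewrite ltr_wpDl // addr_ge0.
have [s s0 dE] := gt0_CxP (divr_gt0 d0 N0).
exists s => // x y /andP[x0 xs] /andP[y0 ys]; apply: dP.
rewrite -ball_normE /= -addrA opprD addNKr normrN.
apply: le_lt_trans (ler_normD _ _) _; rewrite !normrZ !norm_rc !ger0_norm //.
rewrite -[d](divfK (lt0r_neq0 N0)) dE.
apply: (@le_lt_trans _ _ (rc s * (`|u| + `|v|))).
  by rewrite mulrDr lerD // ler_wpM2r // lecR.
by rewrite ltr_pM2l ?ltrDl // ltcR.
Qed.

(** The second difference over a box is symmetric in [u] and [v], so the two mixed derivatives agree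
    at some points of arbitrarily small boxes at [z], though not at the same point. Their continuity
    at [z] excludes a gap of [2 e]. *)
Lemma re_schwarz (D : set V) (f : V -> C) (z u v : V) : open D -> D z ->
  holomorphic D f ->
  re ('d (fun w => 'd f w u) z v) = re ('d (fun w => 'd f w v) z u).
Proof.
move=> oD Dz hf.
have cont a b : {for z, continuous (fun w => 'd (fun w' => 'd f w' a) w b)}.
  apply: differentiable_continuous.
  exact: (((hf 2).2 a).2 b).1.
apply/eqP; rewrite -subr_eq0 -normr_eq0; apply/negPn/negP => ne0.
have e0 : 0 < `|re ('d (fun w => 'd f w u) z v) - re ('d (fun w => 'd f w v) z u)| / 2.
  by rewrite divr_gt0 // lt0r ne0 normr_ge0.
move: e0; set e := _ / 2 => e0.
have re0 : 0 < rc e by rewrite ltcR.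
have := cont v u => /cvgrPdist_lt /(_ _ re0).
have := cont u v => /cvgrPdist_lt /(_ _ re0).
have nD : \forall w \near z, D w by exact: open_nbhs_nbhs (conj oD Dz).
move=> nA nB.
have [s s0 sP] := near_box u v (filterI (filterI nA nB) nD).
have sP' (y x : R) (ys : 0 <= y <= s) (xs : 0 <= x <= s) :=
  eq_ind _ _ (sP x y xs ys) _ (addrAC z (rc x *: u) (rc y *: v)).
have [x [y [xs ys E1]]] := @mean_value_box D f z u v s (hf 1) s0
  (fun x y xs ys => (sP x y xs ys).2).
have [y' [x' [ys' xs' E2]]] := @mean_value_box D f z v u s (hf 1) s0
  (fun y x ys xs => (sP' y x ys xs).2).
have E : re ('d (fun w => 'd f w u) (z + rc x *: u + rc y *: v) v) =
    re ('d (fun w => 'd f w v) (z + rc y' *: v + rc x' *: u) u).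
  apply: (mulIf (lt0r_neq0 s0)); apply: (mulIf (lt0r_neq0 s0)).
  apply: etrans (esym E1) _; apply: etrans _ E2.
  by rewrite [z + rc s *: v + rc s *: u]addrAC; ring.
have [[A1 _] _] := sP x y xs ys; have [[_ B1] _] := sP' y' x' ys' xs'.
have {}A1 := le_lt_trans (re_le_norm _) A1.
have {}B1 := le_lt_trans (re_le_norm _) B1.
rewrite ltcR reB in A1; rewrite ltcR reB in B1.
have close (a b a' b' : R) : a' = b' -> `|a - a'| < e -> `|b - b'| < e ->
    `|a - b| < e + e.
  move=> -> ae be; rewrite -(subrKA b'); apply: le_lt_trans (ler_normD _ _) _.
  by rewrite ltrD // distrC.
by have := close _ _ _ _ E A1 B1; rewrite /e -splitr ltxx.
Qed.

Lemma diff_symmetric (D : set V) (f : V -> C) (z u v : V) : open D -> D z ->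
  holomorphic D f ->
  'd (fun w => 'd f w u) z v = 'd (fun w => 'd f w v) z u.
Proof.
move=> oD Dz hf; apply/eqP; rewrite eq_complex; apply/andP; split; apply/eqP.
  exact: re_schwarz oD Dz hf.
(* Since [Re (i w) = - Im w], the imaginary parts are compared by applying the real statement to
   [i f]. *)
pose ii : C := 'i%C; pose g w : C := ii * f w.
have hg : holomorphic D g by apply: holomorphicM => //; exact: holomorphic_cst.
have dZ (h : V -> C) w a : differentiable h w ->
    'd (fun w => ii * h w) w a = ii * 'd h w a.
  by move=> dh; exact: (congr1 (fun k => k a) (@diffZ C V C h ii w dh)).
have E a b : 'd (fun w => 'd g w a) z b = ii * 'd (fun w => 'd f w a) z b.
  rewrite -dZ; last exact: holomorphic_differentiable (holomorphic_diff a hf) Dz.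
  have dg : \forall w \near z, ii * 'd f w a = 'd g w a.
    apply: filterS (open_nbhs_nbhs (conj oD Dz)) => w Dw.
    rewrite -dZ //; exact: holomorphic_differentiable hf Dw.
  have hd : differentiable (fun w => ii * 'd f w a) z.
    apply: holomorphic_differentiable Dz.
    by apply: holomorphicM => //; [exact: holomorphic_cst|exact: holomorphic_diff].
  exact: (congr1 (fun k => k b) (near_eq_differentiable dg hd).2).
have ri (w : C) : re (ii * w) = - complex.Im w.
  by case: w => a b; rewrite /ii /= mul0r mul1r sub0r.
have S := re_schwarz u v oD Dz hg.
have S' := etrans (esym (congr1 re (E u v))) (etrans S (congr1 re (E v u))).
by apply: oppr_inj; apply: etrans (esym (ri _)) (etrans S' (ri _)).
Qed.

End Schwarz.

(** * Logarithmic differentials on a manifold *)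

(** Needed for changes of charts, whose holomorphy is given coordinate by coordinate. *)
Lemma differentiable_rV (K : numFieldType) (V : normedModType K) (n : nat)
    (f : V -> 'rV[K]_n) (z : V) :
  (forall j, differentiable (fun y => f y ord0 j) z) -> differentiable f z.
Proof.
move=> df.
have -> : f = \sum_(j < n) (fun y => f y ord0 j *: delta_mx ord0 j).
  apply: funext => y; rewrite fct_sumE [LHS]row_sum_delta //.
apply: differentiable_sum => j; exact: differentiableZl.
Qed.

Section Charts.
Variables (R : realType) (n : nat) (X : complex_manifold R n).
Local Notation C := (Cx R).
Local Notation V := 'rV[C]_n.
Implicit Types (W : set X) (a b : chart X) (f u : X -> C).

Definition chart_img a W : set V := cmap a @` (W `&` cdom a).

Lemma chart_imgE a W z : chart_img a W z -> W (cinv a z) /\ cdom a (cinv a z).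
Proof. by move=> [x [Wx ax] <-]; rewrite cmapK. Qed.

Lemma chart_imgK a W z : chart_img a W z -> cmap a (cinv a z) = z.
Proof. by move=> [x [Wx ax] <-]; rewrite cmapK. Qed.

Lemma chart_img_cmap a W x : W x -> cdom a x -> chart_img a W (cmap a x).
Proof. by move=> Wx ax; exists x. Qed.

(** Inside the open image of the whole chart, this set is the preimage of [W] under the continuous
    map [cinv a]. *)
Lemma open_chart_img a W : open W -> open (chart_img a W).
Proof.
move=> oW; rewrite openE => z Wz; have [Wz' az] := chart_imgE Wz.
have Dz : (cmap a @` cdom a) z by case: Wz => x [_ ax] <-; exists x.
have := @cinv_continuous _ _ X a.
rewrite continuous_open_subspace; last exact: cimg_open.
move=> /(_ z (mem_set Dz)) cz.
have nW : nbhs z (cinv a @^-1` W) by apply: cz; exact: open_nbhs_nbhs.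
have nD : nbhs z (cmap a @` cdom a).
  by apply: open_nbhs_nbhs; split=> //; exact: cimg_open.
apply: filterS (filterI nW nD) => y [Wy [x ax xy]].
by exists x => //; split=> //; move: Wy; rewrite -xy /= cmapK.
Qed.

Lemma holomorphic_on_eq W f g : open W -> (forall x, W x -> f x = g x) ->
  holomorphic_on W f -> holomorphic_on W g.
Proof.
move=> oW fg hf a; apply: holomorphic_eq (hf a); first exact: open_chart_img.
by move=> z /chart_imgE[Wz _]; exact: fg.
Qed.

Lemma chart_img_sub a W W' : W' `<=` W -> chart_img a W' `<=` chart_img a W.
Proof. by move=> sW z [x [/sW Wx ax] <-]; exists x. Qed.

Lemma holomorphic_on_sub W W' f : W' `<=` W ->
  holomorphic_on W f -> holomorphic_on W' f.
Proof. by move=> sW hf a; apply: holomorphic_sub (hf a); exact: chart_img_sub. Qed.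

Lemma holomorphic_on_local W f : open W ->
  (forall x, W x -> exists2 W', open W' /\ W' x & holomorphic_on (W `&` W') f) ->
  holomorphic_on W f.
Proof.
move=> oW H a; apply: holomorphic_local => z [x [Wx ax] <-].
have [W' [oW' W'x] hf] := H x Wx.
exists (chart_img a (W `&` W')); last exact: hf.
by split; [apply: open_chart_img; exact: openI|exact: chart_img_cmap].
Qed.

Lemma holomorphic_on_mulV (m : nat) W (h h' : X -> 'M[C]_m) : open W ->
  holomorphic_GL W h -> holomorphic_GL W h' ->
  forall r s, holomorphic_on W (fun x => (h x *m invmx (h' x)) r s).
Proof.
move=> oW [hh _] [hh' uh'] r s a; have oD := @open_chart_img a W oW.
have hV := @holomorphic_invmx R n m _ (fun z => h' (cinv a z)) oD
  (fun r s => hh' r s a) (fun z Dz => uh' _ (chart_imgE Dz).1).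
apply: holomorphic_eq oD _ (holomorphic_sum (index_enum 'I_m) oD (fun j _ =>
  holomorphicM oD (hh r j a) (hV j s))) => z _.
by rewrite mxE.
Qed.

Lemma near_chart a W x (P : V -> Prop) : open W -> W x -> cdom a x ->
  (forall z, chart_img a W z -> P z) -> \forall z \near cmap a x, P z.
Proof.
move=> oW Wx ax HP; apply: filterS HP _.
by apply: open_nbhs_nbhs; split; [exact: open_chart_img|exact: chart_img_cmap].
Qed.

Lemma differentiable_chart W f a x : holomorphic_on W f -> W x -> cdom a x ->
  differentiable (fun z => f (cinv a z)) (cmap a x).
Proof.
move=> hf Wx ax; apply: holomorphic_differentiable (hf a) _.
exact: chart_img_cmap.
Qed.

Definition dlog u a x (v : V) : C :=
  (u x)^-1 * 'd (fun z => u (cinv a z)) (cmap a x) v.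

Lemma dlog_linear u a x : linear (dlog u a x : V -> C^o).
Proof.
move=> c v w; rewrite /dlog linearP mulrDr; congr (_ + _).
exact: mulrCA.
Qed.

Lemma dlogM u u' u'' W a x : open W -> W x -> cdom a x ->
  holomorphic_on W u -> holomorphic_on W u' ->
  (forall y, W y -> u y != 0) -> (forall y, W y -> u' y != 0) ->
  (forall y, W y -> u y * u' y = u'' y) ->
  forall v, dlog u a x v + dlog u' a x v = dlog u'' a x v.
Proof.
move=> oW Wx ax hu hu' u0 u0' uM v.
have du := differentiable_chart hu Wx ax.
have du' := differentiable_chart hu' Wx ax.
have nE : \forall z \near cmap a x,
    u (cinv a z) * u' (cinv a z) = u'' (cinv a z).
  by apply: near_chart oW Wx ax _ => z /chart_imgE[Wz _]; exact: uM.
have E : 'd (fun z => u'' (cinv a z)) (cmap a x) v =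
    u x * 'd (fun z => u' (cinv a z)) (cmap a x) v +
    u' x * 'd (fun z => u (cinv a z)) (cmap a x) v.
  have dM := @differentiableM C V _ _ _ du du'.
  apply: etrans (congr1 (fun h => h v)
    (@near_eq_differentiable C V C _ _ _ nE dM).2) _.
  apply: etrans (congr1 (fun h => h v) (@diffM C V _ _ _ du du')) _.
  by rewrite /= cmapK.
have alg (p q A B : C) : p != 0 -> q != 0 ->
    p^-1 * A + q^-1 * B = (p * q)^-1 * (p * B + q * A).
  by move=> p0 q0; field; rewrite q0.
apply: etrans (alg _ _ _ _ (u0 x Wx) (u0' x Wx)) _.
by apply: congr2; [rewrite uM|exact: esym E].
Qed.

(** The chain rule for [u] read in chart [a] as [u] read in chart [b] after the change of charts, an
    identity holding only near [cmap a x]. *)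
Lemma dlog_chart u W a b x v : open W -> W x -> cdom a x -> cdom b x ->
  holomorphic_on W u ->
  dlog u a x v = dlog u b x ('d (fun z => cmap b (cinv a z)) (cmap a x) v).
Proof.
move=> oW Wx ax bx hu; congr (_ * _).
have db : differentiable (fun z => u (cinv b z)) (cmap b x).
  exact: differentiable_chart hu Wx bx.
have dab : differentiable (fun z => cmap b (cinv a z)) (cmap a x).
  apply: differentiable_rV => j.
  apply: holomorphic_differentiable (chart_change a b j) _; by exists x.
have db' : differentiable (fun z => u (cinv b z)) (cmap b (cinv a (cmap a x))).
  by rewrite cmapK.
have nE : \forall z \near cmap a x,
    ((fun z => u (cinv b z)) \o (fun z => cmap b (cinv a z))) z = u (cinv a z).
  apply: (@near_chart a (cdom b)) => // [|z /chart_imgE[bz az]].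
    exact: cdom_open.
  by rewrite /= cmapK.
have dC := @differentiable_comp C V V C _ _ _ dab db'.
apply: etrans (congr1 (fun h => h v)
  (@near_eq_differentiable C V C _ _ _ nE dC).2) _.
apply: etrans (congr1 (fun h => h v) (@diff_comp C V V C _ _ _ dab db')) _.
by rewrite /= cmapK.
Qed.

Lemma dlog_chart_img u W a z v : chart_img a W z ->
  dlog u a (cinv a z) v = (u (cinv a z))^-1 * 'd (fun z => u (cinv a z)) z v.
Proof. by move=> Wz; rewrite /dlog (chart_imgK Wz). Qed.

Lemma holomorphic_dlog u W a v : open W -> holomorphic_on W u ->
  (forall y, W y -> u y != 0) ->
  holomorphic (chart_img a W) (fun z => dlog u a (cinv a z) v).
Proof.
move=> oW hu u0; have oD := @open_chart_img a W oW.
have hV : holomorphic (chart_img a W) (fun z => (u (cinv a z))^-1).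
  by apply: holomorphicV oD _ (hu a) => z /chart_imgE[Wz _]; exact: u0.
apply: holomorphic_eq oD _ (holomorphicM oD hV (holomorphic_diff v (hu a))).
by move=> z Wz; rewrite (dlog_chart_img u v Wz).
Qed.

(** Closedness of a 1-form is symmetry of its derivative. Differentiating [F^-1 * 'd F z v] gives a
    second differential, symmetric by [diff_symmetric], and the visibly symmetric term
    [- F^-2 * 'd F v * 'd F w]. *)
Lemma dlog_closed u W a x v w : open W -> W x -> cdom a x ->
  holomorphic_on W u -> (forall y, W y -> u y != 0) ->
  'd (fun z => dlog u a (cinv a z) v) (cmap a x) w =
  'd (fun z => dlog u a (cinv a z) w) (cmap a x) v.
Proof.
move=> oW Wx ax hu u0; have oD := @open_chart_img a W oW.
pose F z := u (cinv a z); have hF : holomorphic (chart_img a W) F := hu a.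
have Dx := chart_img_cmap Wx ax.
have F0 : F (cmap a x) != 0 by rewrite /F cmapK // u0.
have dF : differentiable F (cmap a x) := holomorphic_differentiable hF Dx.
have dV := @differentiableV C V F _ dF F0.
have E v' w' : 'd (fun z => dlog u a (cinv a z) v') (cmap a x) w' =
    (F (cmap a x))^-1 * 'd (fun z => 'd F z v') (cmap a x) w' +
    'd F (cmap a x) v' * (- (F (cmap a x)) ^- 2 * 'd F (cmap a x) w').
  have nE : \forall z \near cmap a x, (F z)^-1 * 'd F z v' =
      dlog u a (cinv a z) v'.
    by apply: near_chart oW Wx ax _ => z Wz; rewrite (dlog_chart_img u _ Wz).
  have ddF : differentiable (fun z => 'd F z v') (cmap a x).
    exact: holomorphic_differentiable (holomorphic_diff v' hF) Dx.
  have dM := @differentiableM C V _ _ _ dV ddF.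
  apply: etrans (congr1 (fun h => h w')
    (@near_eq_differentiable C V C _ _ _ nE dM).2) _.
  apply: etrans (congr1 (fun h => h w') (@diffM C V _ _ _ dV ddF)) _.
  apply: (congr1 (fun c => (F (cmap a x))^-1 * 'd (fun z => 'd F z v') (cmap a x) w' +
    'd F (cmap a x) v' * c)).
  exact: (congr1 (fun h => h w') (@diffV C V F _ dF F0)).
apply: etrans (E v w) _; apply: etrans _ (esym (E w v)).
apply: congr2; first by apply: congr1; exact: diff_symmetric oD Dx hF.
have alg (p q c : C) : p * (c * q) = q * (c * p) by ring.
exact: alg.
Qed.

End Charts.

(** * Transition systems *)

Lemma eq_mulmx_cV (K : nzRingType) (m p : nat) (A B : 'M[K]_(m, p)) :
  (forall c : 'cV_p, A *m c = B *m c) -> A = B.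
Proof.
move=> AB; apply/matrixP => r s.
by have /matrixP/(_ r ord0) := AB (delta_mx s ord0); rewrite -!colE !mxE.
Qed.

Lemma mulmx_trig_diag (K : nzRingType) (m : nat) (A B : 'M[K]_m) :
  (forall r s : 'I_m, (s < r)%N -> A r s = 0) ->
  (forall r s : 'I_m, (s < r)%N -> B r s = 0) ->
  forall r, (A *m B) r r = A r r * B r r.
Proof.
move=> A0 B0 r; rewrite mxE (bigD1 r) //= big1 ?addr0 // => l lr.
case: (ltngtP l r) => [lr'|rl|/val_inj e]; last by rewrite e eqxx in lr.
  by rewrite A0 ?mul0r.
by rewrite B0 ?mulr0.
Qed.

Lemma bij_surj (A B : Type) (f : A -> B) (y : B) :
  bijective f -> exists x, f x = y.
Proof. by move=> [f' _ fK]; exists (f' y). Qed.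

Section Transition.
Variables (R : realType) (n M : nat) (X : complex_manifold R n).
Variables (E : vector_bundle X M) (F : full_flag E) (U : open_cover X).
Variable g : cover_idx U -> cover_idx U -> X -> 'M[Cx R]_M.
Hypothesis hg : transition_system F g.
Local Notation C := (Cx R).
Local Notation US := (@cover_set R n X U).

Lemma transition_mul i j k x : US i x -> US j x -> US k x ->
  g i j x *m g j k x = g i k x.
Proof.
move: hg => [phi [triv tr]] ix jx kx; apply: eq_mulmx_cV => c.
have [_ /(bij_surj c)] := (triv k).1.1 x kx.
by move=> [v <-]; rewrite -mulmxA -!(tr _ _ x).
Qed.

Lemma transition_id i x : US i x -> g i i x = 1%:M.
Proof.
move: hg => [phi [triv tr]] ix; apply: eq_mulmx_cV => c.
have [_ /(bij_surj c)] := (triv i).1.1 x ix.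
by move=> [v <-]; rewrite -(tr _ _ x) // mul1mx.
Qed.

Lemma transition_inv i j x : US i x -> US j x -> invmx (g i j x) = g j i x.
Proof.
move=> ix jx; have H := transition_mul jx ix jx; rewrite transition_id // in H.
by have [_ ug] := mulmx1_unit H; rewrite -[LHS]mul1mx -H mulmxK.
Qed.

(** Indices start at 0, so the basis vector [s] lies in [C^(s+1)] and comes from step [s.+1] of the
    flag; the other trivialization sends that step to [C^(s+1)] again, where the entries [r > s]
    vanish. *)
Lemma transition_trig i j x (r s : 'I_M) : US i x -> US j x -> (s < r)%N ->
  g i j x r s = 0.
Proof.
move: hg => [phi [triv tr]] ix jx sr.
have [_ /(bij_surj (delta_mx s ord0))[v ve]] := (triv j).1.1 x jx.
have := (triv j).2 s.+1 (ltn_ord s) x jx v; rewrite ve => -[_ H].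
have Sv : flag_step F s.+1 v.
  by apply: H => t st; rewrite mxE -val_eqE /= gtn_eqF.
have := ((triv i).2 s.+1 (ltn_ord s) x ix v).1 Sv r sr.
by rewrite (tr i j x) // ve -colE mxE.
Qed.

(** Locally [g i j] is [h h'^-1], where [h] and [h'] compare the two trivializations with one from
    the atlas of the bundle. *)
Lemma transition_holomorphic i j (r s : 'I_M) :
  holomorphic_on (US i `&` US j) (fun x => g i j x r s).
Proof.
move: hg => [phi [triv tr]].
have oU : open (US i `&` US j) by apply: openI; exact: cover_open.
apply: holomorphic_on_local => // x [ix jx].
have [t tx] := tdom_cover E x.
exists (tdom t); first by split=> //; exact: tdom_open.
set W := _ `&` _; have oW : open W by apply: openI => //; exact: tdom_open.
have [h [hh uh] th] := (triv i).1.2 t.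
have [h' [hh' uh'] th'] := (triv j).1.2 t.
have Wi : W `<=` US i `&` tdom t by move=> y [[]].
have Wj : W `<=` US j `&` tdom t by move=> y [[]].
have hW : holomorphic_GL W h.
  by split=> [p q|y /Wi/uh //]; exact: holomorphic_on_sub Wi (hh p q).
have hW' : holomorphic_GL W h'.
  by split=> [p q|y /Wj/uh' //]; exact: holomorphic_on_sub Wj (hh' p q).
apply: holomorphic_on_eq oW _ (holomorphic_on_mulV oW hW hW' r s) => y Wy.
have [[iy jy] ty] := Wy.
suff -> : g i j y = h y *m invmx (h' y) by [].
suff <- : g i j y *m h' y = h y by rewrite mulmxK //; exact: hW'.2.
apply: eq_mulmx_cV => c.
have [_ /(bij_surj c)[v <-]] := tmap_iso ty.
by rewrite -mulmxA -(th' y) // -(th y) // -(tr i j y).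
Qed.

Lemma transition_diag_mul i j k x m : US i x -> US j x -> US k x ->
  g i j x m m * g j k x m m = g i k x m m.
Proof.
move=> ix jx kx; rewrite -(transition_mul ix jx kx) mulmx_trig_diag //.
  by move=> r s; exact: transition_trig.
by move=> r s; exact: transition_trig.
Qed.

Lemma transition_diag_inv i j x m : US i x -> US j x ->
  g j i x m m = (g i j x m m)^-1.
Proof.
move=> ix jx; have := transition_diag_mul m ix jx ix.
by rewrite transition_id // mxE eqxx => /(mulr1_eq) ->.
Qed.

Lemma transition_diag_neq0 i j x m : US i x -> US j x -> g i j x m m != 0.
Proof.
move=> ix jx; have := transition_diag_mul m ix jx ix.
rewrite transition_id // mxE eqxx => e; apply/eqP => z.
by move/eqP: e; rewrite z mul0r eq_sym oner_eq0.
Qed.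

(** The entry vanishes on the whole open overlap, hence so does its differential. *)
Lemma diff_transition_trig i j a x (r s : 'I_M) v :
  US i x -> US j x -> cdom a x -> (s < r)%N ->
  'd (fun z => g i j (cinv a z) r s) (cmap a x) v = 0.
Proof.
move=> ix jx ax sr.
have oU : open (US i `&` US j) by apply: openI; exact: cover_open.
have nE : \forall z \near cmap a x, cst 0 z = g i j (cinv a z) r s.
  apply: (near_chart oU (conj ix jx) ax) => z /chart_imgE[[iz jz] _].
  by rewrite transition_trig.
have d0 := @differentiable_cst C 'rV[C]_n C 0 (cmap a x).
apply: etrans (congr1 (fun h => h v)
  (@near_eq_differentiable C _ C _ _ _ nE d0).2) _.
exact: (congr1 (fun h => h v) (@diff_cst C 'rV[C]_n C 0 (cmap a x))).
Qed.

Lemma maurer_cartan_trig i j a x (r s : 'I_M) w :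
  US i x -> US j x -> cdom a x -> (s < r)%N ->
  maurer_cartan (g i j) a x r s w = 0.
Proof.
move=> ix jx ax sr; rewrite mxE mxE big1 // => l _.
rewrite transition_inv // mxE; have [lr|rl] := ltnP l r.
  by rewrite transition_trig // mul0r.
by rewrite diff_transition_trig ?mulr0 //; exact: leq_trans rl.
Qed.

Lemma maurer_cartan_diag i j a x r w : US i x -> US j x -> cdom a x ->
  maurer_cartan (g i j) a x r r w = dlog (fun y => g i j y r r) a x (w ord0).
Proof.
move=> ix jx ax; rewrite mxE mxE (bigD1 r) //= big1 ?addr0 => [|l lr].
  by rewrite transition_inv // mxE (transition_diag_inv r ix jx).
rewrite transition_inv // mxE.
case: (ltngtP l r) => [lr'|rl|/val_inj e]; last by rewrite e eqxx in lr.
  by rewrite transition_trig // mul0r.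
by rewrite diff_transition_trig // mulr0.
Qed.

Lemma refined_T_cochainE k i a x v : cover_inter i x -> cdom a x ->
  refined_T_cochain g k i a x v =
  \sum_(s : 'S_k.+1) (-1) ^+ s / (k.+1)`!%:R * \sum_(m < M)
    \det (\matrix_(l < k, c < k)
      dlog (fun y => g (i (s (widen_ord (leqnSn k) l))) (i (s ord_max)) y m m)
        a x (v c)).
Proof.
move=> ix ax; apply: eq_bigr => s _; congr (_ * _); apply: eq_bigr => m _.
pose al (r : 'I_M) (l : 'I_k) :=
  dlog (fun y => g (i (s (widen_ord (leqnSn k) l))) (i (s ord_max)) y r r) a x.
apply: (@wedge_prod_trig R n M k (fun l => maurer_cartan
  (g (i (s (widen_ord (leqnSn k) l))) (i (s ord_max))) a x) al _ _).2.
- by move=> l r t w; exact: maurer_cartan_trig.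
- by move=> l r w; exact: maurer_cartan_diag.
Qed.

(** Diagonal entries of triangular matrices multiply, so [g_ij g_jk = g_ik] passes to them. With a
    fixed reference index [k], the form [dlog g_ik] is the potential [y_i]. *)
Lemma dlog_transition i j k a x m v : US i x -> US j x -> US k x -> cdom a x ->
  dlog (fun y => g i j y m m) a x v =
  dlog (fun y => g i k y m m) a x v - dlog (fun y => g j k y m m) a x v.
Proof.
move=> ix jx kx ax.
have oW : open (US i `&` US j `&` US k).
  by apply: openI; [apply: openI|]; exact: cover_open.
have Wx : (US i `&` US j `&` US k) x by [].
rewrite -(@dlogM _ _ _ (fun y => g i j y m m) (fun y => g j k y m m)
  (fun y => g i k y m m) _ a x oW Wx ax) ?addrK //.
- by apply: holomorphic_on_sub (transition_holomorphic i j m m) => y [].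
- by apply: holomorphic_on_sub (transition_holomorphic j k m m) => y [[]].
- by move=> y [[iy jy] _]; exact: transition_diag_neq0.
- by move=> y [[iy jy] ky]; exact: transition_diag_neq0.
- by move=> y [[iy jy] ky]; exact: transition_diag_mul.
Qed.

(** The tuple is presented as a subtuple [t] of a larger one so that all faces of a simplex share
    the reference index [i ord_max], including the face that omits it. *)
Lemma refined_T_cochain_augment k p (i : 'I_p.+1 -> cover_idx U)
    (t : 'I_k.+1 -> 'I_p.+1) a x v : cover_inter i x -> cdom a x ->
  refined_T_cochain g k (fun m => i (t m)) a x v =
  \sum_(m < M) \det (augment (fun q c =>
    dlog (fun y => g (i (t q)) (i ord_max) y m m) a x (v c))).
Proof.
move=> ix ax; rewrite refined_T_cochainE //.
under eq_bigr => s _.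
  under eq_bigr => m _.
    under eq_mx => l c do rewrite (@dlog_transition _ _ (i ord_max)) //.
    rewrite (det_diff_perm (fun q c =>
      dlog (fun y => g (i (t q)) (i ord_max) y m m) a x (v c))).
    over.
  (* The sign of [s] meets the same sign from [det_diff_perm]; the [(k+1)!] equal terms then cancel
     the normalization. *)
  rewrite -mulr_sumr mulrACA -expr2 sqrr_sign mul1r.
  over.
by rewrite sumr_const card_Sn -[LHS]mulr_natl mulrA divff ?mul1r //.
Qed.

Lemma refined_T_cech_closed k :
  cochain_eq (cech_d (refined_T_cochain g k)) (fun _ _ _ _ => 0).
Proof.
move=> i _ a x v ix ax; rewrite /cech_d.
under eq_bigr => j _ do rewrite (@refined_T_cochain_augment k _ i) // mulr_sumr.
rewrite exchange_big big1 // => m _.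
exact: (alternating_sum_augment (fun q c =>
    dlog (fun y => g (i q) (i ord_max) y m m) a x (v c))).
Qed.

End Transition.

(** * Closedness of wedge products of logarithmic differentials *)

Section DiffBigop.
Variables (K : numFieldType) (V : normedModType K).

Lemma diff_big_sum (I : Type) (r : seq I) (F : I -> V -> K) (z w : V) :
  (forall i, differentiable (F i) z) ->
  differentiable (fun y => \sum_(i <- r) F i y) z /\
  'd (fun y => \sum_(i <- r) F i y) z w = \sum_(i <- r) 'd (F i) z w.
Proof.
move=> dF; elim: r => [|i r [dr IH]].
  have E : (fun y => \sum_(i <- [::]) F i y) = cst 0.
    by apply: funext => y; rewrite big_nil.
  rewrite E big_nil; split; first exact: differentiable_cst.
  exact: (congr1 (fun h => h w) (@diff_cst K V K 0 z)).
have E : (fun y => \sum_(j <- i :: r) F j y) = F i + (fun y => \sum_(j <- r) F j y).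
  by apply: funext => y; rewrite big_cons.
rewrite E big_cons -IH; split; first exact: differentiableD.
exact: (congr1 (fun h => h w) (@diffD K V K _ _ z (dF i) dr)).
Qed.

(** As [r] has no repetition, the filter [j != i] removes exactly the factor being
    differentiated. *)
Lemma diff_big_prod (I : eqType) (r : seq I) (F : I -> V -> K) (z w : V) :
  uniq r -> (forall i, differentiable (F i) z) ->
  differentiable (fun y => \prod_(i <- r) F i y) z /\
  'd (fun y => \prod_(i <- r) F i y) z w =
  \sum_(i <- r) 'd (F i) z w * \prod_(j <- r | j != i) F j z.
Proof.
move=> + dF; elim: r => [_|i r IH /= /andP[ir ur]].
  have E : (fun y => \prod_(i <- [::]) F i y) = cst 1.
    by apply: funext => y; rewrite big_nil.
  rewrite E big_nil; split; first exact: differentiable_cst.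
  exact: (congr1 (fun h => h w) (@diff_cst K V K 1 z)).
have [dr Er] := IH ur.
have E : (fun y => \prod_(j <- i :: r) F j y) = F i * (fun y => \prod_(j <- r) F j y).
  by apply: funext => y; rewrite big_cons.
rewrite E; split; first exact: differentiableM.
have dM : 'd (F i * (fun y => \prod_(j <- r) F j y)) z w =
    F i z * 'd (fun y => \prod_(j <- r) F j y) z w +
    (\prod_(j <- r) F j z) * 'd (F i) z w.
  exact: (congr1 (fun h => h w) (@diffM K V _ _ z (dF i) dr)).
apply: etrans dM (etrans (addrC _ _) _).
have Pi : \prod_(j <- i :: r | j != i) F j z = \prod_(j <- r) F j z.
  rewrite big_cons eqxx /= big_seq_cond [RHS]big_seq_cond.
  apply: eq_bigl => j; rewrite andbT andb_idr // => jr.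
  by apply: contraNneq ir => <-.
rewrite big_cons Pi; apply: congr2; first exact: mulrC.
apply: etrans (congr1 (fun c => F i z * c) Er) _; rewrite mulr_sumr.
apply: eq_big_seq => l lr; rewrite big_cons.
have -> : i != l by apply: contraNneq ir => ->.
exact: mulrCA.
Qed.

End DiffBigop.

Section ClosedForms.
Variables (R : realType) (n : nat) (X : complex_manifold R n).
Local Notation C := (Cx R).
Local Notation V := 'rV[C]_n.

Lemma det_multilinear_cols (k : nat) (f : 'I_k -> V -> C) (v : 'I_k -> V)
    (j : 'I_k) (c : C) (p p' : V) :
  (forall l, f l (c *: p + p') = c * f l p + f l p') ->
  \det (\matrix_(l, m) f l (if m == j then c *: p + p' else v m)) =
  c * \det (\matrix_(l, m) f l (if m == j then p else v m)) +
  \det (\matrix_(l, m) f l (if m == j then p' else v m)).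
Proof.
move=> fL; rewrite -[X in _ = _ + X]mul1r -!(det_tr (\matrix_(_, _) _)).
apply: (@determinant_multilinear _ _ _ _ _ j).
- by apply/rowP => l; rewrite !mxE eqxx fL mul1r.
- by apply/matrixP => r l; rewrite !mxE [_ == j]eq_sym (negbTE (neq_lift _ _)).
- by apply/matrixP => r l; rewrite !mxE [_ == j]eq_sym (negbTE (neq_lift _ _)).
Qed.

Lemma dlog_form_closed (k : nat) (W : set X) (u : 'I_k -> X -> C) : open W ->
  (forall l, holomorphic_on W (u l)) -> (forall l y, W y -> u l y != 0) ->
  closed_holomorphic_form W
    (fun a x v => \det (\matrix_(l < k, c < k) dlog (u l) a x (v c))).
Proof.
move=> oW hu u0; split.
- move=> a x Wx ax v j c p p'.
  apply: (@det_multilinear_cols k (fun l => dlog (u l) a x)) => l.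
  by rewrite dlog_linear.
- move=> a x Wx ax v i j ij vij; rewrite -det_tr.
  by apply: (determinant_alternate ij) => l; rewrite !mxE vij.
- move=> a b x Wx ax bx v; congr determinant; apply/matrixP => l c.
  rewrite mxE [RHS]mxE; exact: dlog_chart oW Wx ax bx (hu l).
- move=> a v; apply: holomorphic_det; first exact: open_chart_img.
  move=> r s; apply: holomorphic_eq (holomorphic_dlog a (v s) oW (hu r) (u0 r)).
    exact: open_chart_img.
  by move=> z _; rewrite mxE.
move=> a x v Wx ax; rewrite /exterior_d.
(* The determinant is expanded over permutations and each product differentiated factor by factor.
   For every fixed [l], the terms in which factor [l] is differentiated cancel by
   [alternating_sum_symmetric], the symmetry of [S l] being [dlog_closed]. *)
pose f (l : 'I_k) (c : 'I_k.+1) (z : V) := dlog (u l) a (cinv a z) (v c).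
have df l c : differentiable (f l c) (cmap a x).
  apply: holomorphic_differentiable (chart_img_cmap Wx ax).
  exact: holomorphic_dlog oW (hu l) (u0 l).
pose S l j c := 'd (f l c) (cmap a x) (v j).
have symS l j c : S l j c = S l c j by exact: dlog_closed oW Wx ax (hu l) (u0 l).
have dP (j : 'I_k.+1) (s : 'S_k) := @diff_big_prod C V _ (index_enum 'I_k)
  (fun l => f l (lift j (s l))) (cmap a x) (v j) (index_enum_uniq _)
  (fun l => df l (lift j (s l))).
have dsP (j : 'I_k.+1) (s : 'S_k) :
    differentiable (fun z => (-1) ^+ s * \prod_l f l (lift j (s l)) z) (cmap a x).
  exact: (@differentiableZ C V C _ ((-1) ^+ s) _ (dP j s).1).
have dE (j : 'I_k.+1) :
    'd (fun z => \det (\matrix_(l < k, c < k) dlog (u l) a (cinv a z) (v (lift j c))))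
       (cmap a x) (v j) =
    \sum_(s : 'S_k) (-1) ^+ s * \sum_l (S l j (lift j (s l)) *
        \prod_(m < k | m != l) f m (lift j (s m)) (cmap a x)).
  have -> : (fun z => \det (\matrix_(l < k, c < k)
        dlog (u l) a (cinv a z) (v (lift j c)))) =
      (fun z => \sum_(s : 'S_k) (-1) ^+ s * \prod_l f l (lift j (s l)) z).
    apply: funext => z; apply: eq_bigr => s _; congr (_ * _).
    by apply: eq_bigr => l _; rewrite mxE.
  apply: etrans (@diff_big_sum C V _ _ _ (cmap a x) (v j) (dsP j)).2 _.
  apply: eq_bigr => s _.
  apply: etrans (congr1 (fun h => h (v j))
    (@diffZ C V C _ ((-1) ^+ s) (cmap a x) (dP j s).1)) _.
  exact: (congr1 (fun c => (-1) ^+ s * c) (dP j s).2).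
under eq_bigr => j _ do rewrite dE.
transitivity (\sum_(l < k) \sum_(j < k.+1) (-1) ^+ j *
     (\sum_(t : 'S_k) (-1) ^+ t * (S l j (lift j (t l)) *
        \prod_(m < k | m != l) f m (lift j (t m)) (cmap a x)))).
  rewrite exchange_big /=; apply: eq_bigr => j _; rewrite -mulr_sumr.
  congr (_ * _); rewrite exchange_big /=; apply: eq_bigr => s _.
  by rewrite mulr_sumr.
apply: big1 => l _.
exact: (alternating_sum_symmetric (fun m c => f m c (cmap a x)) l (symS l)).
Qed.

Lemma exterior_d_eq (q : nat) (W : set X) (w w' : Defs.form X q) a x v : open W ->
  form_eq_on W w w' -> W x -> cdom a x ->
  (forall v, differentiable (fun z => w a (cinv a z) v) (cmap a x)) ->
  exterior_d w a x v = exterior_d w' a x v.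
Proof.
move=> oW ww' Wx ax dw; apply: eq_bigr => j _; apply: (congr1 ( *%R ((-1) ^+ j))).
pose v' := (fun m => v (lift j m)).
have nE : \forall z \near cmap a x, w a (cinv a z) v' = w' a (cinv a z) v'.
  by apply: near_chart oW Wx ax _ => z /chart_imgE[Wz az]; exact: ww'.
exact: esym (congr1 (fun h => h (v j))
  (@near_eq_differentiable C V C _ _ _ nE (dw v')).2).
Qed.

Lemma closed_form_differentiable (q : nat) (W : set X) (w : Defs.form X q) a x v :
  closed_holomorphic_form W w -> W x -> cdom a x ->
  differentiable (fun z => w a (cinv a z) v) (cmap a x).
Proof.
move=> cw Wx ax.
apply: holomorphic_differentiable (form_holomorphic cw a v) _.
exact: chart_img_cmap.
Qed.

(** Lets the cochain be replaced by its determinant formula, which is valid only over the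
    intersection of the cover sets and inside chart domains. *)
Lemma closed_form_eq (q : nat) (W : set X) (w w' : Defs.form X q) : open W ->
  form_eq_on W w w' -> closed_holomorphic_form W w ->
  closed_holomorphic_form W w'.
Proof.
move=> oW ww' cw; split.
- move=> a x Wx ax v j c p p'; rewrite -!ww' //.
  exact: form_multilinear cw _ _ Wx ax _ _ _ _ _.
- move=> a x Wx ax v i j ij vij; rewrite -ww' //.
  exact: form_alternating cw _ _ Wx ax _ _ _ ij vij.
- move=> a b x Wx ax bx v; rewrite -!ww' //.
  exact: form_chart_change cw _ _ _ Wx ax bx _.
- move=> a v; apply: holomorphic_eq (form_holomorphic cw a v).
    exact: open_chart_img.
  by move=> z /chart_imgE[Wz az]; exact: ww'.
move=> a x v Wx ax; rewrite -(exterior_d_eq v oW ww' Wx ax).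
  exact: form_closed cw _ _ _ Wx ax.
move=> v'; exact: closed_form_differentiable cw Wx ax.
Qed.

Lemma closed_form_sum (q : nat) (W : set X) (I : Type) (r : seq I)
    (w : I -> Defs.form X q) : open W ->
  (forall i, closed_holomorphic_form W (w i)) ->
  closed_holomorphic_form W (fun a x v => \sum_(i <- r) w i a x v).
Proof.
move=> oW cw; split.
- move=> a x Wx ax v j c p p'; rewrite mulr_sumr -big_split /=.
  apply: eq_bigr => i _; exact: form_multilinear (cw i) _ _ Wx ax _ _ _ _ _.
- move=> a x Wx ax v l j lj vlj; apply: big1 => i _.
  exact: form_alternating (cw i) _ _ Wx ax _ _ _ lj vlj.
- move=> a b x Wx ax bx v; apply: eq_bigr => i _.
  exact: form_chart_change (cw i) _ _ _ Wx ax bx _.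
- move=> a v; apply: holomorphic_sum; first exact: open_chart_img.
  by move=> i _; exact: form_holomorphic (cw i) a v.
move=> a x v Wx ax; rewrite /exterior_d.
transitivity (\sum_(i <- r) exterior_d (w i) a x v); last first.
  by apply: big1 => i _; exact: form_closed (cw i) _ _ _ Wx ax.
rewrite /exterior_d exchange_big /=; apply: eq_bigr => j _.
rewrite -mulr_sumr; apply: (congr1 ( *%R ((-1) ^+ j))).
apply: (@diff_big_sum C V I r (fun i z => w i a (cinv a z) (fun m => v (lift j m)))
  (cmap a x) (v j) _).2 => i.
exact: closed_form_differentiable (cw i) Wx ax.
Qed.

End ClosedForms.

Lemma open_cover_inter (R : realType) (n : nat) (X : complex_manifold R n)
    (U : open_cover X) (p : nat) (i : 'I_p -> cover_idx U) : open (cover_inter i).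
Proof.
rewrite openE => x ix; apply: filter_forall => m.
by apply: open_nbhs_nbhs; split; [exact: cover_open|exact: ix].
Qed.

Lemma refined_T_cocycle (R : realType) (n M : nat) (X : complex_manifold R n)
    (E : vector_bundle X M) (F : full_flag E) (U : open_cover X)
    (g : cover_idx U -> cover_idx U -> X -> 'M[Cx R]_M) (k : nat) :
  transition_system F g -> cocycle (refined_T_cochain g k).
Proof.
move=> hg; split; last exact: refined_T_cech_closed hg k.
move=> i _; have oW := open_cover_inter i.
pose u (m : 'I_M) (l : 'I_k) (y : X) :=
  g (i (widen_ord (leqnSn k) l)) (i ord_max) y m m.
apply: (@closed_form_eq _ _ _ k _ (fun a x v =>
  \sum_(m < M) \det (\matrix_(l < k, c < k) dlog (u m l) a x (v c))) _ oW).
  move=> a x v ix ax; rewrite [RHS](refined_T_cochain_augment hg id v ix ax).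
  apply: eq_bigr => m _; rewrite det_augment; congr determinant.
  apply/matrixP => l c; rewrite mxE [RHS]mxE.
  (* With the last two indices equal, the subtracted term is the [dlog] of a diagonal entry of
     [g_ii], which is the row of [ord_max] on the other side. *)
  by rewrite [LHS](dlog_transition hg _ _ (ix _) (ix ord_max) (ix ord_max) ax).
apply: closed_form_sum => // m; apply: dlog_form_closed => // l.
  apply: holomorphic_on_sub (transition_holomorphic hg _ _ m m) => y iy.
  by split; exact: iy.
by move=> y iy; exact: (transition_diag_neq0 hg m (iy _) (iy _)).
Qed.

(** * Refinements and the union of two covers *)

Lemma strict_mono_ord_ge (p : nat) (f : 'I_p -> 'I_p) :
  (forall a b : 'I_p, (a < b)%N -> (f a < f b)%N) -> forall a : 'I_p, (a <= f a)%N.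
Proof.
move=> fm [m]; elim: m => [//|m IH] mp.
exact: leq_ltn_trans (IH (ltnW mp)) (fm (Ordinal (ltnW mp)) (Ordinal mp) (ltnSn m)).
Qed.

(** Both [s] and its inverse are strictly increasing, and a strictly increasing self-map of ['I_p]
    lies above the identity. *)
Lemma increasing_perm (d : Order.disp_t) (I : orderType d) (p : nat)
    (i : 'I_p -> I) (s : 'S_p) :
  increasing i -> increasing (fun m => i (s m)) -> s = 1%g.
Proof.
move=> /forallP incI /forallP incS.
have lti (a b : 'I_p) : (a < b)%N -> (i a < i b)%O.
  by move: (incI a) => /forallP/(_ b)/implyP; exact.
have lts (a b : 'I_p) : (a < b)%N -> (s a < s b)%N.
  move=> ab; have := incS a => /forallP/(_ b)/implyP/(_ ab) isab.
  rewrite ltnNge leq_eqVlt; apply/negP => /orP[/eqP/val_inj/perm_inj e|/lti].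
    by rewrite e ltnn in ab.
  by move/(lt_trans isab); rewrite ltxx.
have ltsV (a b : 'I_p) : (a < b)%N -> ((s^-1)%g a < (s^-1)%g b)%N.
  move=> ab; rewrite ltnNge leq_eqVlt.
  apply/negP => /orP[/eqP/val_inj/perm_inj e|/lts].
    by rewrite e ltnn in ab.
  by rewrite !permKV => /(ltn_trans ab); rewrite ltnn.
apply/permP => a; rewrite perm1; apply/val_inj/eqP.
rewrite eqn_leq; apply/andP; split; last exact: (strict_mono_ord_ge lts).
by have := strict_mono_ord_ge ltsV (s a); rewrite permK.
Qed.

Section Refinement.
Variables (R : realType) (n : nat) (X : complex_manifold R n).
Local Notation C := (Cx R).

(** For a strictly increasing refinement map the alternating extension reduces to its term at the
    identity permutation, so no signs occur. *)
Lemma refine_cochain_mono (q p : nat) (U V : open_cover X)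
    (r : cover_idx V -> cover_idx U) (c : cochain q U p)
    (j : 'I_p.+1 -> cover_idx V) :
  {homo r : x y / (x < y)%O} -> increasing j ->
  refine_cochain r c j = (fun a x v => c (fun m => r (j m)) a x v).
Proof.
move=> rm incj.
have incr : increasing (fun m => r (j m)).
  apply/forallP => a; apply/forallP => b; apply/implyP => ab; apply: rm.
  by move/forallP: incj => /(_ a)/forallP/(_ b)/implyP; exact.
have E : (fun m => r (j ((1%g : 'S_p.+1) m))) = (fun m => r (j m)).
  by apply: funext => m; rewrite perm1.
apply/funext => a; apply/funext => x; apply/funext => v.
rewrite /refine_cochain (big_pred1 (1%g : 'S_p.+1)) => [|s].
  by rewrite odd_perm1 mul1r E.
rewrite /=; apply/idP/eqP => [incs|->]; last by rewrite E.
exact: increasing_perm incr incs.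
Qed.

Lemma coboundary_eq (q p : nat) (U : open_cover X) (c c' : cochain q U p) :
  cochain_eq c c' -> coboundary c -> coboundary c'.
Proof.
move=> cc'; case: p c c' cc' => [|p] c c' cc'.
  by move=> c0 i inci a x v ix ax; rewrite -(cc' i inci a x v ix ax); exact: c0.
move=> [b hb cb]; exists b => // i inci a x v ix ax.
by rewrite -(cc' i inci a x v ix ax); exact: cb.
Qed.

Lemma cohomology_class_eq (q p : nat) (U : open_cover X) (c c' : cochain q U p) :
  cochain_eq c c' -> cohomology_class c = cohomology_class c'.
Proof.
move=> cc'; apply/seteqP; split=> b [hb bc]; split=> //;
  apply: coboundary_eq bc => i inci a x v ix ax;
  by rewrite (cc' i inci a x v ix ax).
Qed.

(** One refinement step relates the two classes, and related elements have the same equivalence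
    class as predicates by symmetry and transitivity. *)
Lemma to_cech_cohomology_refine (q p : nat) (U V : open_cover X)
    (r : cover_idx V -> cover_idx U) (c : cochain q U p) (c' : cochain q V p)
    (hc : cocycle c) (hc' : cocycle c') :
  refinement r -> {homo r : x y / (x < y)%O} ->
  (forall j, increasing j -> c' j = c (fun m => r (j m))) ->
  to_cech_cohomology (to_cover_cohomology hc) =
  to_cech_cohomology (to_cover_cohomology hc').
Proof.
move=> rr rm cr; apply: eq_exist.
set h := existT _ U _; set h' := existT _ V _.
have hh' : cohomology_refines h h'.
  exists r, c; split=> //; apply: cohomology_class_eq => j incj a x v _ _.
  by rewrite (refine_cochain_mono c rm incj) cr.
apply/funext => k; apply/propext; split=> hk.
  exact: rst_trans (rst_sym _ _ _ _ (rst_step _ _ _ _ hh')) hk.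
exact: rst_trans (rst_step _ _ _ _ hh') hk.
Qed.

End Refinement.

Section OrderedSum.
Variables (d d' : Order.disp_t) (I : orderType d) (J : orderType d').

(** A separate name to which the order is attached. Every element of [I] precedes every element of
    [J], which makes both inclusions strictly increasing. *)
Definition ordered_sum : Type := I + J.

HB.instance Definition _ := Choice.on ordered_sum.

Definition ordered_sum_le (x y : ordered_sum) : bool :=
  match x, y with
  | inl a, inl b => (a <= b)%O
  | inr a, inr b => (a <= b)%O
  | inl _, inr _ => true
  | inr _, inl _ => false
  end.

Lemma ordered_sum_le_refl : reflexive ordered_sum_le.
Proof. by case=> a /=. Qed.

Lemma ordered_sum_le_anti : antisymmetric ordered_sum_le.
Proof. by case=> [a|a] [b|b] //= /le_anti ->. Qed.

Lemma ordered_sum_le_trans : transitive ordered_sum_le.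
Proof. by case=> [a|a] [b|b] [c|c] //=; exact: le_trans. Qed.

HB.instance Definition _ := Order.Le_isPOrder.Build d ordered_sum
  ordered_sum_le_refl ordered_sum_le_anti ordered_sum_le_trans.

Lemma ordered_sum_le_total : total (<=%O : rel ordered_sum).
Proof. by case=> [a|a] [b|b] //; exact: le_total. Qed.

HB.instance Definition _ := Order.POrder_isTotal.Build d ordered_sum
  ordered_sum_le_total.

Lemma inl_lt : {homo (inl : I -> ordered_sum) : x y / (x < y)%O}.
Proof.
by move=> a b; rewrite !lt_neqAle.
Qed.

Lemma inr_lt : {homo (inr : J -> ordered_sum) : x y / (x < y)%O}.
Proof.
by move=> a b; rewrite !lt_neqAle.
Qed.

End OrderedSum.

Section SumCover.
Variables (R : realType) (n : nat) (X : complex_manifold R n).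
Variables (U U' : open_cover X).

Definition sum_cover_set
    (i : ordered_sum (cover_idx U) (cover_idx U')) : set X :=
  match i with inl a => cover_set a | inr b => cover_set b end.

Lemma sum_cover_open i : open (sum_cover_set i).
Proof. by case: i => a; exact: cover_open. Qed.

Lemma sum_cover_full x : exists i, sum_cover_set i x.
Proof. by have [i ix] := cover_full U x; exists (inl i). Qed.

Definition sum_cover : open_cover X := OpenCover sum_cover_open sum_cover_full.

End SumCover.

(** The matrix is that of [f] composed with the inverse of [g]; the transposes are there because
    [lin1_mx] acts on row vectors. *)
Lemma linear_bijective_mx (K : fieldType) (V : lmodType K) (m : nat)
    (f g : V -> 'cV[K]_m) : linear f -> linear g -> bijective g ->
  exists h : 'M[K]_m, forall v, f v = h *m g v.
Proof.
move=> fL gL bg; have [g' gK g'K] := bg.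
have g'L : linear g'.
  by move=> c u v; apply: (bij_inj bg); rewrite gL !g'K.
pose k (w : 'rV[K]_m) := (f (g' w^T))^T.
have kL : linear k by move=> c u v; rewrite /k !linearP g'L fL linearP.
pose kk : {linear 'rV[K]_m -> 'rV[K]_m} :=
  HB.pack k (GRing.isLinear.Build _ _ _ _ k kL).
exists (lin1_mx kk)^T => v.
by rewrite -[RHS]trmxK trmx_mul trmxK mul_rV_lin1 /= /k !trmxK gK.
Qed.

(** * Independence of the cover and of the transition functions *)

Section Independence.
Variables (R : realType) (n M : nat) (X : complex_manifold R n).
Variables (E : vector_bundle X M) (F : full_flag E).

(** The matrices are chosen point by point. Their holomorphy follows from [transition_holomorphic]
    once they belong to a transition system. *)
Lemma exists_transition (W W' : set X) (phi psi : forall x, fibre E x -> 'cV[Cx R]_M) :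
  fibrewise_iso W phi -> fibrewise_iso W' psi ->
  exists h, transition_on (W `&` W') phi psi h.
Proof.
move=> iphi ipsi.
have /choice[h hP] : forall x, exists h : 'M[Cx R]_M,
    (W `&` W') x -> forall v, phi x v = h *m psi x v.
  (* Outside the overlap the value is arbitrary. *)
  move=> x; have [[Wx Wx']|nW] := pselect ((W `&` W') x); last by exists 0.
  have [h hP] := linear_bijective_mx (iphi x Wx).1 (ipsi x Wx').1 (ipsi x Wx').2.
  by exists h.
by exists h.
Qed.

(** The diagonal blocks are the given systems themselves; only the mixed blocks, comparing a
    trivialization over [U] with one over [U'], have to be chosen. *)
Lemma sum_transition_system (U U' : open_cover X)
    (g : cover_idx U -> cover_idx U -> X -> 'M[Cx R]_M)
    (g' : cover_idx U' -> cover_idx U' -> X -> 'M[Cx R]_M) :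
  transition_system F g -> transition_system F g' ->
  exists2 G : cover_idx (sum_cover U U') -> cover_idx (sum_cover U U') ->
      X -> 'M[Cx R]_M,
    transition_system F G &
    (forall i j, G (inl i) (inl j) = g i j) /\
    (forall i j, G (inr i) (inr j) = g' i j).
Proof.
move=> [phi [tphi trphi]] [phi' [tphi' trphi']].
have ex12 i j := exists_transition (tphi i).1.1 (tphi' j).1.1.
have ex21 j i := exists_transition (tphi' j).1.1 (tphi i).1.1.
have /choice[h12 h12P] : forall i, exists H, forall j, transition_on
    (cover_set i `&` cover_set j) (phi i) (phi' j) (H j).
  by move=> i; have [H HP] := choice (ex12 i); exists H.
have /choice[h21 h21P] : forall j, exists H, forall i, transition_on
    (cover_set j `&` cover_set i) (phi' j) (phi i) (H i).
  by move=> j; have [H HP] := choice (ex21 j); exists H.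
exists (fun i j => match i, j with
  | inl i, inl j => g i j
  | inl i, inr j => h12 i j
  | inr i, inl j => h21 i j
  | inr i, inr j => g' i j
  end) => //.
exists (fun i => match i with inl i => phi i | inr i => phi' i end).
split=> [[i|i]|[i|i] [j|j]].
- exact: tphi.
- exact: tphi'.
- exact: trphi.
- exact: h12P.
- exact: h21P.
- exact: trphi'.
Qed.

End Independence.

Theorem theorem1p14 (R : realType) (n M k : nat) (X : complex_manifold R n)
    (E : vector_bundle X M) (F : full_flag E) (hk : (0 < k)%N) :
  exists hatf : forall (U : open_cover X)
      (g : cover_idx U -> cover_idx U -> X -> 'M[Cx R]_M),
      transition_system F g -> cocycle (refined_T_cochain g k),
    forall (U : open_cover X)
      (g : cover_idx U -> cover_idx U -> X -> 'M[Cx R]_M)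
      (hg : transition_system F g)
      (U' : open_cover X)
      (g' : cover_idx U' -> cover_idx U' -> X -> 'M[Cx R]_M)
      (hg' : transition_system F g'),
      refined_T_invariant (hatf U g hg) = refined_T_invariant (hatf U' g' hg').
Proof.
exists (fun U g hg => refined_T_cocycle k hg) => U g hg U' g' hg'.
have [G hG [Gl Gr]] := sum_transition_system hg hg'.
(* Equality as functions makes the restricted cochain literally the given one, as
   [to_cech_cohomology_refine] requires. *)
have gE : g = (fun i j => G (inl i) (inl j)).
  by apply: funext => i; apply: funext => j.
have gE' : g' = (fun i j => G (inr i) (inr j)).
  by apply: funext => i; apply: funext => j.
apply: (etrans (y := refined_T_invariant (refined_T_cocycle k hG))).
  apply: esym; apply: (@to_cech_cohomology_refine _ _ _ _ _ (sum_cover U U') U inl).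
  - by move=> j x.
  - exact: inl_lt.
  - by move=> j _; rewrite gE.
apply: (@to_cech_cohomology_refine _ _ _ _ _ (sum_cover U U') U' inr).
- by move=> j x.
- exact: inr_lt.
- by move=> j _; rewrite gE'.
Qed.
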